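(* Let $T$ be a complete first-order theory with monster model $\mathfrak{C}$, let $A$ be a small set and let $p(x)$ be a partial type over $A$ (with $x$ a finite tuple of variables) which is independent, i.e. $\operatorname{rk-dp}(p)=\infty$. Then there exist a set $A'\supseteq A$ with $A'\setminus A$ finite, a realization $a\models p$, and sequences $\langle I_i \mid i<|T|^{+}+|A|^{+}\rangle$ which are mutually indiscernible over $A'$, each $I_i$ being a sequence of singletons (elements, not tuples), such that for every $i$, $I_i$ is not indiscernible over $A'\cup\{a\}$ (written $A'a$).
   Context: $T$ is a complete first-order theory and $\mathfrak{C}$ a monster model; all sets of parameters are small subsets of $\mathfrak{C}$. A family of sequences $\{I_i\}$ is mutually indiscernible over a set $B$ if each $I_i$ is indiscernible over $B\cup\bigcup_{j\neq i}I_j$. For a partial type $p(x)$ over $A$ and a cardinal $\kappa$, we write $\operatorname{rk-dp}(p)<\kappa$ if for every realization $a$ of $p$ and every family of $\kappa$ sequences mutually indiscernible over $A$, at least one of these sequences is indiscernible over $A\cup\{a\}$. We say $\operatorname{rk-dp}(p)=\infty$ (and call $p$ independent) if $\operatorname{rk-dp}(p)<\kappa$ holds for no cardinal $\kappa$; otherwise $p$ is called dependent. *)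

(* Defs.v *)
From HB Require Import structures.
From mathcomp Require Import all_boot all_order.
From mathcomp Require Import boolp classical_sets functions cardinality.

Set Implicit Arguments.
Unset Strict Implicit.
Unset Printing Implicit Defensive.

Local Open Scope classical_set_scope.
Local Open Scope card_scope.

Record language := Language {
  fun_symb : Type;
  fun_arity : fun_symb -> nat;
  rel_symb : Type;
  rel_arity : rel_symb -> nat }.

Inductive term (L : language) (V : Type) : Type :=
| Var of V
| App (f : fun_symb L) of ('I_(fun_arity f) -> term L V).

(* [formula L V]: the free variables are elements of V. A quantifier binds the
   variable [None] of [option V]. *)
Inductive formula (L : language) (V : Type) : Type :=
| Bot
| Eq of term L V & term L V
| Rel (r : rel_symb L) of ('I_(rel_arity r) -> term L V)
| Imp of formula L V & formula L V
| All of formula L (option V).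

Definition Neg (L : language) (V : Type) (phi : formula L V) : formula L V :=
  Imp phi (Bot L V).

Definition sentence (L : language) : Type := formula L void.

Record structure (L : language) := Structure {
  carrier :> Type;
  carrier_inh : inhabited carrier;
  fun_interp : forall f : fun_symb L, ('I_(fun_arity f) -> carrier) -> carrier;
  rel_interp : forall r : rel_symb L, ('I_(rel_arity r) -> carrier) -> Prop }.

Fixpoint eval (L : language) (M : structure L) (V : Type) (v : V -> M)
    (t : term L V) : M :=
  match t with
  | Var x => v x
  | App f ts => fun_interp (fun i => eval v (ts i))
  end.

Fixpoint sat (L : language) (M : structure L) (V : Type) (phi : formula L V) :
    (V -> M) -> Prop :=
  match phi with
  | Bot => fun=> False
  | Eq s t => fun v => eval v s = eval v t
  | Rel r ts => fun v => rel_interp (fun i => eval v (ts i))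
  | Imp phi1 phi2 => fun v => sat phi1 v -> sat phi2 v
  | All phi1 => fun v => forall a : M, sat phi1 (oapp v a)
  end.

Definition models (L : language) (M : structure L) (T : set (sentence L)) :=
  forall phi : sentence L, T phi -> sat phi (of_void M).

Definition entails (L : language) (T : set (sentence L)) (phi : sentence L) :=
  forall M : structure L, models M T -> sat phi (of_void M).

Definition complete_theory (L : language) (T : set (sentence L)) :=
  (exists M : structure L, models M T) /\
  (forall phi : sentence L, entails T phi \/ entails T (Neg phi)).

(* A cardinal is represented by any type (or set) of that cardinality. *)
Definition card_lt (S U : Type) (X : set S) (Y : set U) : Prop :=
  X #<= Y /\ ~ (Y #<= X).

Definition is_succ_card (S : Type) (X : set S) (K : Type) : Prop :=
  card_lt X [set: K] /\
  (forall Y : Type, card_lt X [set: Y] -> [set: K] #<= [set: Y]).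

Definition strong_limit (kbar : Type) : Prop :=
  forall X : Type,
    card_lt [set: X] [set: kbar] -> card_lt [set: set X] [set: kbar].

Definition pformula (L : language) (M : structure L) (B : set M) (V : Type) :=
  formula L (B + V)%type.

Definition passign (L : language) (M : structure L) (B : set M) (V : Type)
    (v : V -> M) (z : B + V) : M :=
  match z with inl b => val b | inr x => v x end.

Definition psat (L : language) (M : structure L) (B : set M) (V : Type)
    (phi : pformula B V) (v : V -> M) : Prop :=
  sat phi (passign v).

Definition realizes (L : language) (M : structure L) (B : set M) (V : Type)
    (v : V -> M) (p : set (pformula B V)) : Prop :=
  forall phi, p phi -> psat phi v.

Definition partial_type (L : language) (M : structure L) (B : set M) (V : Type)
    (p : set (pformula B V)) : Prop :=
  forall F : set (pformula B V), finite_set F -> F `<=` p ->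
    exists v : V -> M, realizes v F.

Definition saturated (kbar : Type) (L : language) (M : structure L) : Prop :=
  forall B : set M, card_lt B [set: kbar] ->
  forall p : set (pformula B unit), partial_type p ->
    exists v : unit -> M, realizes v p.

Definition automorphism (L : language) (M : structure L) (s : M -> M) : Prop :=
  [/\ bijective s,
      forall (f : fun_symb L) (x : 'I_(fun_arity f) -> M),
        s (fun_interp x) = fun_interp (s \o x)
    & forall (r : rel_symb L) (x : 'I_(rel_arity r) -> M),
        rel_interp (s \o x) <-> rel_interp x].

Definition strongly_homogeneous (kbar : Type) (L : language)
    (M : structure L) : Prop :=
  forall B : set M, card_lt B [set: kbar] ->
  forall f : B -> M,
    (forall phi : formula L B, sat phi (fun b : B => val b) <-> sat phi f) ->
    exists2 s : M -> M, automorphism s & forall b : B, s (val b) = f b.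

(* "Small" means of cardinality < kbar. As kbar is a strong limit, |T|^+ + |A|^+
   is small whenever A is. *)
Record monster (kbar : Type) (L : language) (T : set (sentence L))
    (C : structure L) : Prop := Monster {
  monster_models : models C T;
  monster_strong_limit : strong_limit kbar;
  monster_language_small : card_lt [set: formula L nat] [set: kbar];
  monster_saturated : saturated kbar C;
  monster_homogeneous : strongly_homogeneous kbar C }.

(* An infinite small linearly ordered sequence of tuples of C; all tuples of a
   sequence are indexed by the same small type [width]. *)
Record sequence (kbar : Type) (L : language) (C : structure L) := Sequence {
  index_disp : Order.disp_t;
  index : orderType index_disp;
  index_infinite : infinite_set [set: index];
  index_small : card_lt [set: index] [set: kbar];
  width : Type;
  width_small : card_lt [set: width] [set: kbar];
  entry : index -> width -> C }.

Section DpRank.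
Variables (kbar : Type) (L : language) (C : structure L).
Implicit Types (s : sequence kbar C) (A B : set C).

Definition elements s : set C :=
  [set c | exists (j : index s) (w : width s), entry j w = c].

Definition of_singletons s : Prop :=
  exists w0 : width s, forall w : width s, w = w0.

Definition subtuple s (n : nat) (j : 'I_n -> index s) (kw : 'I_n * width s) : C :=
  entry (j kw.1) kw.2.

Definition indiscernible s B : Prop :=
  forall (n : nat) (j j' : 'I_n -> index s),
    {homo j : k l / (k < l)%O} -> {homo j' : k l / (k < l)%O} ->
  forall phi : pformula B ('I_n * width s),
    psat phi (subtuple j) <-> psat phi (subtuple j').

Definition mutually_indiscernible (K : Type) (I : K -> sequence kbar C) B : Prop :=
  forall i : K,
    indiscernible (I i) (B `|` \bigcup_(j in [set~ i]) elements (I j)).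

Definition rk_dp_lt A (n : nat) (p : set (pformula A 'I_n)) (kappa : Type) : Prop :=
  forall a : 'I_n -> C, realizes a p ->
  forall I : kappa -> sequence kbar C, mutually_indiscernible I A ->
    exists i : kappa, indiscernible (I i) (A `|` range a).

(* rk-dp(p) = oo. As for parameter sets, only small cardinals are considered:
   no family of more than |C| non-constant sequences is mutually
   indiscernible. *)
Definition independent A (n : nat) (p : set (pformula A 'I_n)) : Prop :=
  forall kappa : Type, card_lt [set: kappa] [set: kbar] -> ~ rk_dp_lt p kappa.

End DpRank.
Arguments independent kbar {L C A n} p.

(* Main.v *)
From Stdlib Require List.
Require Import Defs.
From HB Require Import structures.
From mathcomp Require Import all_boot all_order.
From mathcomp Require Import boolp classical_sets functions cardinality.
From mathcomp Require Import filter zify.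

(** If rk-dp(p) = oo, the pigeonhole principle and mutual indiscernibility yield a
    formula th(x, y) that has the independence property with x ranging over
    realizations of p and y a finite tuple of elements. Exchange the roles of x and
    y: there are an indiscernible sequence u of realizations of p and a tuple
    e = (e_0, .., e_(r-1)) such that th(u_j, e) holds iff j is even. Take k maximal
    such that u can be chosen indiscernible over e_0, .., e_(k-1). By compactness
    some finite set of formulas shows that no end segment of u is indiscernible
    over e_0, .., e_k. Choosing blocks of u on which one of these formulas changes
    its truth value gives the independence property again, now between the single
    element e_k and finite tuples of realizations of p, over the extra parameters
    e_0, .., e_(k-1). Run the same argument once more with the roles exchanged: it
    produces an indiscernible sequence of elements and one realization a of p that
    destroys indiscernibility on every end segment, over finitely many extra
    parameters. Cutting a long such sequence into blocks gives the family of
    mutually indiscernible sequences. *)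

Set Implicit Arguments.
Unset Strict Implicit.
Unset Printing Implicit Defensive.

Local Open Scope classical_set_scope.
Local Open Scope card_scope.

(** * Formulas and their variables *)

Section Lists.
Implicit Types T U : Type.

(** Finiteness by an enclosing list and [List.In], which makes sense over any [Type], in particular
    over the types of variables. *)
Definition listed T (X : set T) := exists s : seq T, forall x, X x -> List.In x s.

Lemma finite_list T (X : set T) :
  finite_set X -> exists s : seq T, forall x, X x <-> List.In x s.
Proof.
move=> finX; have [s Xs] : exists s : seq {classic T}, X = [set` s].
  by apply/(@finite_seqP {classic T}).
exists s => x; rewrite Xs /=; elim: (s : seq {classic T}) => //= y s' IH.
rewrite inE -IH; split=> [/orP[/eqP->|]|[->|->]]; rewrite ?eqxx ?orbT //.
  by left.
by right.
Qed.

Lemma listed_exact T (X : set T) :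
  listed X -> exists s : seq T, forall x, X x <-> List.In x s.
Proof.
move=> [s Xs]; exists (List.filter (fun x => asbool (X x)) s) => x.
by rewrite List.filter_In; split=> [Xx|[_ /asboolP]//]; split; [exact: Xs|exact/asboolP].
Qed.

Lemma listed_fst T U (X : set (T * U)) : listed X -> listed [set x | exists y, X (x, y)].
Proof.
move=> [s Xs]; exists (map fst s) => x [y /Xs xy]; apply/List.in_map_iff.
by exists (x, y).
Qed.

Lemma listed_inr T U (X : set (T + U)) : listed X -> listed [set y | X (inr y)].
Proof.
move=> [s Xs]; exists (pmap (fun z => if z is inr y then Some y else None) s) => y /Xs.
elim: s {Xs} => //= z s IH [->|/IH]; first by left.
by case: z => [x|y'] //= ?; right.
Qed.

Lemma listed_choice (n : nat) T (X : 'I_n -> set T) :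
  (forall i, listed (X i)) -> listed [set x | exists i, X i x].
Proof.
move=> /choice[s Xs]; exists (flatten [seq s i | i <- enum 'I_n]) => x [i Xix].
have : i \in enum 'I_n by rewrite mem_enum.
elim: (enum _) => //= j e IH; rewrite inE => /orP[/eqP<-|/IH xe].
  by apply/List.in_or_app; left; apply: Xs.
by apply/List.in_or_app; right.
Qed.

Lemma list_choice T U (R : T -> U -> Prop) (s : seq T) :
  (forall x, List.In x s -> exists y, R x y) ->
  exists t : seq U, (forall x, List.In x s -> exists2 y, List.In y t & R x y) /\
    forall y, List.In y t -> exists2 x, List.In x s & R x y.
Proof.
elim: s => [|x s IH] Rs; first by exists [::]; split.
have [y Rxy] := Rs x (or_introl erefl).
have [t [st ts]] := IH (fun z zs => Rs z (or_intror zs)).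
exists (y :: t); split=> [z [<-|/st[w wt Rzw]]|w [<-|/ts[z zs Rzw]]].
- by exists y => //; left.
- by exists w => //; right.
- by exists x => //; left.
- by exists z => //; right.
Qed.

Lemma list_bound (f : nat -> nat) (s : seq nat) :
  exists M, forall x, List.In x s -> (f x < M)%N.
Proof.
elim: s => [|x s [M Ms]]; first by exists 0.
exists (maxn M (f x).+1) => y [<-|/Ms yM]; first by rewrite leq_max leqnn orbT.
by rewrite leq_max yM.
Qed.

Lemma In_mem T (s : seq {classic T}) (x : {classic T}) : List.In x s -> x \in s.
Proof.
elim: s => //= y s IH [->|/IH xs]; first by rewrite mem_head.
by rewrite inE xs orbT.
Qed.

Lemma list_separate T (s : seq T) :
  exists f : T -> nat, forall x y, List.In x s -> List.In y s -> f x = f y -> x = y.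
Proof.
exists (fun x => index (x : {classic T}) s) => x y xs ys.
have {}xs := @In_mem T s x xs; have {}ys := @In_mem T s y ys.
by move=> /(congr1 (nth (x : {classic T}) s)); rewrite !nth_index.
Qed.

Lemma In_map T U (f : T -> U) (s : seq T) (y : U) :
  List.In y (map f s) <-> exists x, f x = y /\ List.In x s.
Proof. exact: List.in_map_iff. Qed.

End Lists.

(** * Renaming, free variables and satisfaction *)

Section Syntax.
Variable L : language.
Implicit Types V W : Type.

Fixpoint trename V W (h : V -> W) (t : term L V) : term L W :=
  match t with
  | Var x => Var L (h x)
  | App f ts => App (fun i => trename h (ts i))
  end.

Fixpoint rename V W (h : V -> W) (phi : formula L V) : formula L W :=
  match phi with
  | Bot => Bot L W
  | Eq s t => Eq (trename h s) (trename h t)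
  | Rel r ts => Rel (fun i => trename h (ts i))
  | Imp phi1 phi2 => Imp (rename h phi1) (rename h phi2)
  | All phi1 => All (rename (omap h) phi1)
  end.

Fixpoint tocc V (t : term L V) : set V :=
  match t with
  | Var x => [set x]
  | App f ts => fun x => exists i, tocc (ts i) x
  end.

Fixpoint occ V (phi : formula L V) : set V :=
  match phi with
  | Bot => set0
  | Eq s t => tocc s `|` tocc t
  | Rel r ts => fun x => exists i, tocc (ts i) x
  | Imp phi1 phi2 => occ phi1 `|` occ phi2
  | All phi1 => fun x => occ phi1 (Some x)
  end.

Lemma listed_tocc V (t : term L V) : listed (tocc t).
Proof.
elim: t => [x|f ts IH] /=; last exact: listed_choice.
by exists [:: x] => y ->; left.
Qed.

Lemma listedU V (X Y : set V) : listed X -> listed Y -> listed (X `|` Y).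
Proof.
move=> [s Xs] [t Yt]; exists (s ++ t) => x [/Xs|/Yt] ?; apply/List.in_or_app;
  by [left|right].
Qed.

Lemma listed_occ V (phi : formula L V) : listed (occ phi).
Proof.
elim: V / phi => [V|V s t|V r ts|V phi1 IH1 phi2 IH2|V phi [s os]] /=.
- by exists [::].
- by apply: listedU; apply: listed_tocc.
- by apply: listed_choice => i; apply: listed_tocc.
- exact: listedU.
- exists (pmap id s) => x /os; elim: s {os} => //= -[y|] s IH /= [].
  + by case=> ->; left.
  + by move/IH; right.
  + by [].
  + by move/IH.
Qed.

Lemma tocc_trename V W (h : V -> W) (t : term L V) :
  tocc (trename h t) = h @` tocc t.
Proof.
elim: t => [x|f ts IH] /=; apply/seteqP; split=> y /=.
- by move=> ->; exists x.
- by move=> [_ -> <-].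
- by move=> [i]; rewrite IH => -[x tx <-]; exists x => //; exists i.
- by move=> [x [i tx] <-]; exists i; rewrite IH; exists x.
Qed.

Lemma occ_rename V W (h : V -> W) (phi : formula L V) :
  occ (rename h phi) = h @` occ phi.
Proof.
elim: V / phi W h => [V|V s t|V r ts|V phi1 IH1 phi2 IH2|V phi IH] W h /=.
- by rewrite image_set0.
- by rewrite !tocc_trename image_setU.
- apply/seteqP; split=> y /=.
    by move=> [i]; rewrite tocc_trename => -[x tx <-]; exists x => //; exists i.
  by move=> [x [i tx] <-]; exists i; rewrite tocc_trename; exists x.
- by rewrite IH1 IH2 image_setU.
- apply/seteqP; split=> y /=; rewrite IH.
    by move=> [[x|] //= ox [<-]]; exists x.
  by move=> [x ox <-]; exists (Some x).
Qed.

Section Semantics.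
Variable C : structure L.

Lemma eval_trename V W (h : V -> W) (t : term L V) (v : W -> C) :
  eval v (trename h t) = eval (v \o h) t.
Proof.
elim: t => //= f ts IH; congr fun_interp; apply/funext => i; exact: IH.
Qed.

Lemma sat_rename V W (h : V -> W) (phi : formula L V) (v : W -> C) :
  sat (rename h phi) v <-> sat phi (v \o h).
Proof.
elim: V / phi W h v => [V|V s t|V r ts|V phi1 IH1 phi2 IH2|V phi IH] W h v //=.
- by rewrite !eval_trename.
- by rewrite (_ : (fun i => _) = (fun i => eval (v \o h) (ts i))) //;
    apply/funext => i; rewrite eval_trename.
- by rewrite IH1 IH2.
- have E a : oapp v a \o omap h = oapp (v \o h) a by apply/funext => -[].
  by split=> H a; have := H a; rewrite IH E.
Qed.

Lemma eval_ext V (t : term L V) (v v' : V -> C) :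
  (forall x, tocc t x -> v x = v' x) -> eval v t = eval v' t.
Proof.
elim: t => [x|f ts IH] /= vv'; first exact: vv'.
by congr fun_interp; apply/funext => i; apply: IH => x tx; apply: vv'; exists i.
Qed.

Lemma sat_ext V (phi : formula L V) (v v' : V -> C) :
  (forall x, occ phi x -> v x = v' x) -> sat phi v <-> sat phi v'.
Proof.
elim: V / phi v v' => [V|V s t|V r ts|V phi1 IH1 phi2 IH2|V phi IH] v v' /= vv' //.
- by rewrite (eval_ext (v' := v')) 1?[eval v t](eval_ext (v' := v')) // => x ?;
    apply: vv'; [right|left].
- rewrite (_ : (fun i => _) = (fun i => eval v' (ts i))) //.
  by apply/funext => i; apply: eval_ext => x tx; apply: vv'; exists i.
- rewrite (IH1 v v') ?(IH2 v v') // => x ?; apply: vv'; by [left|right].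
- have E a : sat phi (oapp v a) <-> sat phi (oapp v' a).
    by apply: IH => -[x|] //= ox; apply: vv'.
  by split=> H a; apply/E.
Qed.

Lemma sat_extW V (phi : formula L V) (v v' : V -> C) :
  (forall x, occ phi x -> v x = v' x) -> sat phi v -> sat phi v'.
Proof. by move=> /sat_ext[]. Qed.

Definition Iff V (phi psi : formula L V) : formula L V :=
  Neg (Imp (Imp phi psi) (Neg (Imp psi phi))).

Lemma sat_Iff V (phi psi : formula L V) (v : V -> C) :
  sat (Iff phi psi) v <-> (sat phi v <-> sat psi v).
Proof.
split=> [/= H|[H1 H2] /= H]; last by apply: H.
by split=> Hp; apply: contrapT => Hq; apply: H => H1 H2; apply: Hq;
  [exact: H1|exact: H2].
Qed.

Definition Conj V (F : seq (formula L V)) : formula L V :=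
  foldr (fun phi psi => Neg (Imp phi (Neg psi))) (Neg (Bot L V)) F.

Lemma sat_Conj V (F : seq (formula L V)) (v : V -> C) :
  sat (Conj F) v <-> forall phi, List.In phi F -> sat phi v.
Proof.
elim: F => [|phi F IH] /=; first by split=> //.
rewrite IH; split=> [H psi|H K]; last first.
  by apply: K => [|psi ps]; apply: H; [left|right].
have [H1 H2] : sat phi v /\ (forall psi, List.In psi F -> sat psi v).
  by apply: contrapT => K; apply: H => H1 H2; apply: K.
by case=> [<-|/H2].
Qed.

Definition setv V (v : V -> C) (x : V) (c : C) (y : V) : C :=
  if asbool (y = x) then c else v y.

(** Quantification over a named variable that keeps the variable type [V]: [x] is renamed to the
    bound [None]. Several such quantifiers can then be iterated with [foldr]. *)
Definition Ex V (x : V) (phi : formula L V) : formula L V :=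
  Neg (All (rename (fun y => if asbool (y = x) then None else Some y) (Neg phi))).

Lemma sat_Ex V (x : V) (phi : formula L V) (v : V -> C) :
  sat (Ex x phi) v <-> exists c, sat phi (setv v x c).
Proof.
have E c : oapp v c \o (fun y => if asbool (y = x) then None else Some y) =
    setv v x c.
  by apply/funext => y; rewrite /setv /=; case: asboolP.
split=> [/= H|[c sc] /= H].
  apply: contrapT => K; apply: H => c; rewrite sat_rename E => sc.
  by apply: K; exists c.
by move: (H c); rewrite sat_rename E; apply.
Qed.

Lemma occ_Ex V (x y : V) (phi : formula L V) :
  occ (Ex x phi) y -> occ phi y /\ y <> x.
Proof.
rewrite /= => -[[|[]]|[]]; rewrite occ_rename => -[z oz].
by case: asboolP => // zx -[<-].
Qed.

Lemma occ_Conj V (F : seq (formula L V)) (y : V) :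
  occ (Conj F) y -> exists2 phi, List.In phi F & occ phi y.
Proof.
elim: F => [|phi F IH] /=; first by move=> [].
move=> [[o|[/IH[psi ps o]|[]]]|[]]; first by exists phi => //; left.
by exists psi => //; right.
Qed.

Lemma sub_occ_Conj V (F : seq (formula L V)) (phi : formula L V) :
  List.In phi F -> occ phi `<=` occ (Conj F).
Proof.
elim: F => //= psi F IH [->|/IH os] y oy; left; first by left.
by right; left; apply: os.
Qed.

Lemma occ_foldr_Ex V (s : seq V) (phi : formula L V) (y : V) :
  occ (foldr (@Ex V) phi s) y -> occ phi y /\ ~ List.In y s.
Proof.
elim: s => [|x s IH]; first by move=> o; split.
rewrite [foldr _ _ _]/= => o.
have [/IH[oy ys] yx] := occ_Ex o.
by split=> // -[/esym|].
Qed.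

Lemma sat_foldr_Ex V (s : seq V) (phi : formula L V) (v : V -> C) :
  sat (foldr (@Ex V) phi s) v <->
  exists2 w, (forall x, ~ List.In x s -> w x = v x) & sat phi w.
Proof.
elim: s v => [|x s IH] v.
  split=> [sv|[w wv]]; first by exists v.
  by rewrite (_ : w = v) //; apply/funext => y; apply: wv.
rewrite [foldr _ _ _]/= sat_Ex; split=> [[c /IH[w wv sw]]|[w wv sw]].
  exists w => // y ys; rewrite wv ?/setv; last by move=> ?; apply: ys; right.
  by case: asboolP => // yx; case: ys; left.
exists (w x); apply/IH; exists w => // y ys; rewrite /setv.
by case: asboolP => [->//|yx]; apply: wv => -[/esym|].
Qed.

End Semantics.

End Syntax.

(** * Small cardinals *)

Section Cardinals.
Implicit Types X Y Z : Type.

Definition injects X Y := exists f : X -> Y, injective f.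

Lemma card_leTP X Y : ([set: X] #<= [set: Y]) <-> injects X Y.
Proof.
split=> [/card_leP[f]|[f injf]].
  exists (fun x => val (f (SigSub (mem_set (I : [set: X] x))))) => x y /val_inj.
  by move=> /(inj (mem_set I) (mem_set I)) /(congr1 val).
by rewrite -(card_le_eql (inj_card_eq (in2W injf))) card_leT.
Qed.

Lemma injects_trans Y X Z : injects X Y -> injects Y Z -> injects X Z.
Proof. by move=> [f injf] [g injg]; exists (g \o f); apply: inj_comp. Qed.

(** By Zorn's lemma there is a maximal graph of a partial bijection. If it misses some [x] in its
    domain and some [y] in its range, the pair [(x, y)] can be added; so it is total on one side. *)
Lemma injects_total X Y : injects X Y \/ injects Y X.
Proof.
pose P (G : set (X * Y)) := forall a b, G a -> G b -> a.1 = b.1 <-> a.2 = b.2.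
have [F FP Ftot|G [PG maxG]] := @Zorn_bigcup _ P.
  move=> a b [G FG Ga] [H FH Hb].
  by case: (Ftot G H FG FH) => GH; [apply: (FP H)|apply: (FP G)] => //; exact: GH.
have [dom|/existsNP[x xG]] := pselect (forall x, exists y, G (x, y)).
  left; have [f Gf] := choice dom; exists f => x x' /=.
  by move=> /(PG _ _ (Gf x) (Gf x')).
have [ran|/existsNP[y yG]] := pselect (forall y, exists x, G (x, y)).
  right; have [f Gf] := choice ran; exists f => y y' /=.
  by move=> /(PG _ _ (Gf y) (Gf y')).
case: (maxG (G `|` [set (x, y)])).
  split=> [a Ga|/(_ (x, y))]; first by left.
  by move=> /(_ (or_intror erefl)) Gxy; apply: xG; exists y.
move=> a b [Ga|->] [Gb|->] //=; first exact: PG.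
  by split=> E; [case: xG; exists a.2|case: yG; exists a.1];
    move: Ga; rewrite (surjective_pairing a) E.
by split=> E; [case: xG; exists b.2|case: yG; exists b.1];
  move: Gb; rewrite (surjective_pairing b) E.
Qed.

Lemma Cantor X : ~ injects (set X) X.
Proof.
move=> [f injf]; pose D := [set x | exists2 S, f S = x & ~ S x].
have [Dx|nDx] := pselect (D (f D)); last by apply: (nDx); exists D.
by case: (Dx) => S /injf -> /(_ Dx).
Qed.

Definition small (kbar X : Type) := card_lt [set: X] [set: kbar].

Section Small.
Variables (kbar : Type) (kbar_lim : strong_limit kbar).

Lemma smallP X : small kbar X <-> ~ injects kbar X.
Proof.
rewrite /small /card_lt !card_leTP; split=> [[]//|nle].
by case: (injects_total X kbar).
Qed.

Lemma small_injects X Y : injects X Y -> small kbar Y -> small kbar X.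
Proof. by rewrite !smallP => XY nY kX; apply: nY; apply: injects_trans kX XY. Qed.

(** If [X] embeds in [Y] by [f], then [x] goes to {{f x}} and [y] to {{y}, {}}. This embeds the sum
    in the double power set of [Y], which is small since [kbar] is a strong limit. *)
Lemma small_sum X Y : small kbar X -> small kbar Y -> small kbar (X + Y).
Proof.
move=> sX sY; wlog : X Y sX sY / injects X Y => [hwlog|[f injf]].
  have [|YX] := injects_total X Y; first by move=> XY; apply: hwlog.
  apply: (small_injects (Y := Y + X)); last exact: hwlog.
  by exists (fun z => match z with inl x => inr x | inr y => inl y end)
    => -[x|y] [x'|y'] // [->].
apply: small_injects (kbar_lim (kbar_lim sY)).
have s1 (y y' : Y) : [set y] = [set y'] -> y = y'.
  by move=> E; have : [set y'] y by rewrite -E.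
exists (fun z => match z with
  inl x => [set [set f x]] | inr y => [set [set y]] `|` [set set0] end).
move=> [x|y] [x'|y'] E.
- have : [set [set f x']] [set f x] by rewrite -E.
  by move=> /s1/injf ->.
- have : [set [set f x]] set0 by rewrite E; right.
  by move=> /= /esym E0; have : [set f x] (f x) by []; rewrite E0.
- have : [set [set f x']] set0 by rewrite -E; right.
  by move=> /= /esym E0; have : [set f x'] (f x') by []; rewrite E0.
- have : ([set [set y']] `|` [set set0]) [set y] by rewrite -E; left.
  move=> [/s1->//|/= E0]; by have : [set y] y by []; rewrite E0.
Qed.

Lemma small_prod X Y : small kbar X -> small kbar Y -> small kbar (X * Y).
Proof.
move=> sX sY; apply: small_injects (kbar_lim (small_sum sX sY)).
exists (fun a => [set z | z = inl a.1 \/ z = inr a.2]) => -[x y] [x' y'] E.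
have : [set z | z = inl x' \/ z = inr y'] (inl x) by rewrite -E; left.
have : [set z | z = inl x' \/ z = inr y'] (inr y) by rewrite -E; right.
by move=> [//|[->]] [[->]|].
Qed.

Lemma small_fun X Y : small kbar X -> small kbar Y -> small kbar (X -> Y).
Proof.
move=> sX sY; apply: small_injects (kbar_lim (small_prod sX sY)).
exists (fun f => [set a | f a.1 = a.2]) => f g E; apply/funext => x.
by have : [set a | g a.1 = a.2] (x, f x) by rewrite -E.
Qed.

Lemma small_set_type (S : Type) (X : set S) : card_lt X [set: kbar] <-> small kbar X.
Proof.
have eX : [set: X] #= X by exact: card_setT.
by rewrite /small /card_lt (card_le_eql eX) (card_le_eqr eX).
Qed.

(** By Cantor's theorem the power set of [X] is larger than [X], so it bounds the successor
    cardinal; it is small by the strong limit property. *)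
Lemma small_succ (S : Type) (X : set S) (K : Type) :
  card_lt X [set: kbar] -> is_succ_card X K -> small kbar K.
Proof.
move=> /small_set_type sX [_ minK]; have eX : [set: X] #= X by exact: card_setT.
have KX : [set: K] #<= [set: set X].
  apply: minK; split.
    rewrite -(card_le_eql eX); apply/card_leTP; exists (fun x => [set x]).
    by move=> x y E; have : [set y] x by rewrite -E.
  by rewrite -(card_le_eqr eX) => /card_leTP; apply: Cantor.
by apply: small_injects (kbar_lim sX); apply/card_leTP.
Qed.

End Small.
End Cardinals.

(** * Compactness *)

Section Compactness.
Variables (kbar : Type) (L : language) (T : set (sentence L)) (C : structure L).
Hypothesis mon : monster kbar T C.

Lemma small_nat : small kbar nat.
Proof.
apply: small_injects (monster_language_small mon).
by exists (fun n => Eq (Var L n) (Var L n)) => n m [].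
Qed.

Lemma small_unit : small kbar unit.
Proof. by apply: small_injects small_nat; exists (fun=> 0) => -[] []. Qed.

Lemma small_ord n : small kbar 'I_n.
Proof. by apply: small_injects small_nat; exists val; exact: val_inj. Qed.

Section Realization.
Variables (V : Type) (W0 : set V) (f0 : V -> C).
Hypothesis small_V : small kbar V.

Section Ultra.
Variable U : set_system (V -> C).
Hypotheses (ultraU : UltraFilter U)
  (U0 : U [set v | forall x, W0 x -> v x = f0 x]).

Let G0 : set (V * C) := [set a | W0 a.1 /\ a.2 = f0 a.1].

(** Partial assignments are kept as graphs, so that Zorn's lemma applies to unions of chains. The
    pairs of [G0] are always adjoined, as the union of an empty chain is empty. *)
Let coherent (G : set (V * C)) :=
  (forall x c c', G (x, c) -> G (x, c') -> c = c') /\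
  forall phi f, U [set v | sat phi v] -> (forall x, occ phi x -> G (x, f x)) ->
    sat phi f.

Let coherent_G0 : coherent G0.
Proof.
split=> [x c c' [_ /= ->] [_ /= ->] //|phi f Uphi fG].
have [v [vf0 sv]] := filter_ex (filterI U0 Uphi).
by apply: sat_extW sv => x /fG[Wx /= ->]; apply: vf0.
Qed.

Let coherent_bigcup (F : set (set (V * C))) :
  F `<=` [set G | coherent (G `|` G0)] -> total_on F subset ->
  coherent ((\bigcup_(G in F) G) `|` G0).
Proof.
move=> Fcoh Ftot; set H := _ `|` G0.
(* Finitely many pairs of [H] lie in a single member of the chain together with [G0]; the
   alternative [G = set0] covers the empty chain. *)
have sub (s : seq (V * C)) : exists2 G, F G \/ G = set0 &
    forall a, List.In a s -> H a -> (G `|` G0) a.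
  elim: s => [|a s [G FG Gs]]; first by exists set0 => //; right.
  have [[[G' FG' G'a]|G0a]|nHa] := pselect (H a); last 2 first.
  - by exists G => // b [<-|/Gs//] _; right.
  - by exists G => // b [<-|/Gs//].
  have [GG'|G'G] : G `<=` G' \/ (G' `<=` G /\ F G).
    case: FG => [FG|->]; last by left.
    by case: (Ftot G G') => //; [left|right].
  - exists G'; first by left.
    move=> b [<- _|bs Hb]; first by left.
    by case: (Gs b bs Hb) => [/GG'|]; [left|right].
  - exists G => // b [<- _|/Gs//]; by left; apply: G'G.1.
have coh G : F G \/ G = set0 -> coherent (G `|` G0).
  by move=> [/Fcoh//|->]; rewrite set0U; exact: coherent_G0.
split=> [x c c' Hc Hc'|phi f Uphi fH].
  have [G /coh[Gfun _] Gs] := sub [:: (x, c); (x, c')].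
  by apply: (Gfun x); apply: Gs => //=; [left|right; left].
have [s os] := listed_occ phi.
have [G /coh[_ Gsat] Gs] := sub [seq (x, f x) | x <- s].
apply: Gsat Uphi _ => x ox; apply: Gs; last exact: fH.
by apply/In_map; exists x; split=> //; apply: os.
Qed.

(** A maximal coherent partial assignment is total: at a missing variable, the formulas true on a
    set of [U] form a type over the fewer than [kbar] values already assigned, and saturation
    supplies a value there. *)
Lemma ultra_realized : exists v : V -> C,
  (forall x, W0 x -> v x = f0 x) /\
  forall phi, U [set v' | sat phi v'] -> sat phi v.
Proof.
have [c0] := carrier_inh C.
have [G [/= [Gfun Gsat] maxG]] := Zorn_bigcup coherent_bigcup.
set H := G `|` G0 in Gfun Gsat.
have /choice[f Hf] : forall x, exists c', (exists c, H (x, c)) -> H (x, c').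
  move=> x; by have [[c Hc]|nH] := pselect (exists c, H (x, c)); [exists c|exists c0 => /nH].
have [dom|/existsNP[x0 x0H]] := pselect (forall x, exists c, H (x, c)).
  exists f; split=> [x Wx|phi Uphi]; last by apply: Gsat => // x _; apply: Hf.
  by apply: (Gfun x); [apply: Hf|right].
exfalso; pose B : set C := [set c | exists y, H (y, c)].
have smallB : card_lt B [set: kbar].
  have [y Hy] := choice (fun b : B => set_mem (valP b)).
  apply/small_set_type; apply: small_injects small_V; exists y => b b' E.
  by apply/val_inj; apply: (Gfun (y b)) => //; rewrite E; apply: Hy.
(* Variables in the domain of [H] become parameters from [B]; [x0] becomes the single free
   variable. *)
pose h (x : V) : B + unit := match pselect (H (x, f x)) with
  | left p => inl (SigSub (mem_set (ex_intro _ x p : B (f x))))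
  | right _ => inr tt end.
have hE phi (v : unit -> C) : (forall y, occ phi y -> y = x0 \/ H (y, f y)) ->
    psat (rename h phi : pformula B unit) v <-> sat phi (setv f x0 (v tt)).
  move=> ophi; rewrite /psat sat_rename; apply: sat_ext => y /ophi oy.
  rewrite /= /h /setv; case: pselect => [Hy|nHy] /=; case: asboolP => // yx.
    by case: x0H; rewrite -yx; exists (f y).
  by case: oy.
pose q : set (pformula B unit) := [set rename h phi | phi in
  [set phi | U [set v | sat phi v] /\ forall y, occ phi y -> y = x0 \/ H (y, f y)]].
(* A finite conjunction of formulas that hold on sets of [U] again holds on a set of [U], and so
   does its quantification over [x0]. The variables left are in the domain of [H], so coherence
   makes the latter true under [f]. *)
have qtype : partial_type q.
  move=> F /finite_list[s Fs] Fq.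
  have [ps /Fs/Fq[phi ? <-]|t [st ts]] := list_choice (s := s) (R := fun ps phi =>
      (U [set v | sat phi v] /\ forall y, occ phi y -> y = x0 \/ H (y, f y)) /\
      rename h phi = ps).
    by exists phi.
  have : sat (Ex x0 (Conj t)) f.
    apply: (Gsat (Ex x0 (Conj t)) f) ; last first.
      move=> y oy; have [oy1 yx0] := occ_Ex oy; have [phi phit oy'] := occ_Conj oy1.
      by have [_ _ [[_ ophi] _]] := ts phi phit; case: (ophi y oy').
    apply: (@filterS _ _ _ [set v | forall phi, List.In phi t -> sat phi v]).
      move=> v tv; apply/sat_Ex; exists (v x0); apply/sat_Conj.
      by rewrite (_ : setv _ _ _ = v) //; apply/funext => y; rewrite /setv;
        case: asboolP => [->|].
    elim: t {st} ts => [|phi t IH] ts; first by apply: filterS filterT => v _ psi [].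
    have [|_ _ [[Uphi _] _]] := ts phi; first by left.
    have Ut : U [set v | forall phi, List.In phi t -> sat phi v].
      by apply: IH => psi pt; apply: ts; right.
    by apply: filterS (filterI Uphi Ut) => v [vphi vt] psi [<-|/vt].
  move=> /sat_Ex[c /sat_Conj ct]; exists (fun=> c) => ps /Fs/st[phi phit [[_ op] <-]].
  by apply/hE => //; apply: ct.
have [v vq] := monster_saturated mon smallB qtype.
apply: (maxG (G `|` [set (x0, v tt)])).
  split=> [a Ga|/(_ (x0, v tt) (or_intror erefl)) Gx0]; first by left.
  by apply: x0H; exists (v tt); left.
rewrite /= setUAC -/H; split=> [x c c'|phi g Uphi gH].
  move=> [Hc|[xx0 cc]] [Hc'|[xx0' cc']]; first exact: Gfun Hc Hc'.
  - by case: x0H; exists c; rewrite -xx0'.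
  - by case: x0H; exists c'; rewrite -xx0.
  - by rewrite cc cc'.
have ophi y : occ phi y -> y = x0 \/ H (y, f y).
  move=> /gH[Hy|[-> _]]; last by left.
  by right; apply: Hf; exists (g y).
have /hE : psat (rename h phi : pformula B unit) v by apply: vq; exists phi.
move=> /(_ ophi); apply: sat_extW => y oy; rewrite /setv; case: asboolP => yx.
  case: (gH y oy) => [Hy|[_ ->]//]; by case: x0H; exists (g y); rewrite -yx.
case: (gH y oy) => [Hy|[/yx]//]; apply: (Gfun y) => //.
by apply: Hf; exists (g y).
Qed.

End Ultra.

(** The solution sets of the finite parts of [Gamma] generate a proper filter; an ultrafilter above
    it is realized by [ultra_realized]. The variables in [W0] have prescribed values and act as
    parameters. *)
Lemma compactness (Gamma : set (formula L V)) :
  (forall F : seq (formula L V), (forall phi, List.In phi F -> Gamma phi) ->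
    exists v : V -> C, (forall x, W0 x -> v x = f0 x) /\
      forall phi, List.In phi F -> sat phi v) ->
  exists v : V -> C, (forall x, W0 x -> v x = f0 x) /\
    forall phi, Gamma phi -> sat phi v.
Proof.
move=> finsat.
pose D (F : seq (formula L V)) : set (V -> C) := [set v |
  (forall x, W0 x -> v x = f0 x) /\ forall phi, List.In phi F -> sat phi v].
pose U0 : set_system (V -> C) := [set S | exists2 F : seq (formula L V),
  (forall phi, List.In phi F -> Gamma phi) & D F `<=` S].
have U0filter : ProperFilter U0.
  apply: Build_ProperFilter_ex => [S [F /finsat[v Dv] DS]|].
    by exists v; apply: DS.
  split=> [|S S' [F FG DS] [F' FG' DS']|S S' SS' [F FG DS]].
  - by exists [::].
  - exists (F ++ F') => [phi /List.in_app_iff[/FG|/FG']//|v [vf0 vF]].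
    by split; [apply: DS|apply: DS']; split=> // phi ?; apply: vF;
      apply/List.in_app_iff; [left|right].
  - by exists F => // v /DS/SS'.
have [U [ultraU U0U]] := ultraFilterLemma U0filter.
have [|v [vf0 vU]] := @ultra_realized U ultraU.
  by apply: U0U; exists [::] => // v [].
exists v; split=> // phi Gphi; apply: vU; apply: U0U.
by exists [:: phi] => [psi [<-|[]]//|w [_]]; apply; left.
Qed.

End Realization.
End Compactness.

(** * Ramsey's theorem *)

Section Ramsey.

Definition increasing (g : nat -> nat) := {homo g : i j / (i < j)%N}.

Lemma increasing_comp g h : increasing g -> increasing h -> increasing (g \o h).
Proof. by move=> ig ih i j /ih/ig. Qed.

Lemma increasing_addl m : increasing (addn m).
Proof. by move=> i j; rewrite ltn_add2l. Qed.

Lemma increasing_id : increasing id.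
Proof. by []. Qed.

Lemma increasing_leq g : increasing g -> {homo g : i j / (i <= j)%N}.
Proof.
by move=> ig i j; rewrite leq_eqVlt => /orP[/eqP->//|/ig/ltnW].
Qed.

Lemma increasing_extend (f : nat -> nat) (M : nat) :
  (forall i j, (i < j < M)%N -> (f i < f j)%N) ->
  exists2 g, increasing g & forall i, (i < M)%N -> g i = f i.
Proof.
move=> incf; pose B := \max_(i < M) f i.
have fB i : (i < M)%N -> (f i <= B)%N.
  by move=> iM; apply: (@leq_bigmax _ (fun i : 'I_M => f i) (Ordinal iM)).
exists (fun i => if (i < M)%N then f i else (B + i).+1) => [i j ij|i ->//].
case: ifP => iM; case: ifP => jM.
- by apply: incf; rewrite ij.
- by rewrite ltnS (leq_trans (fB i iM)) // leq_addr.
- by rewrite (ltn_trans ij jM) in iM.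
- by rewrite ltnS ltn_add2l.
Qed.

Section Ultra.
Variable U : set_system nat.
Hypotheses (ultraU : UltraFilter U) (evU : eventually `<=` U).

Lemma near_all (T : Type) (s : seq T) (A : T -> set nat) :
  (forall x, List.In x s -> U (A x)) -> U [set i | forall x, List.In x s -> A x i].
Proof.
elim: s => [|x s IH] Us; first by apply: filterS filterT => i _ y [].
have Ux := Us x (or_introl erefl); have Uss := IH (fun y ys => Us y (or_intror ys)).
by apply: filterS (filterI Ux Uss) => i [xi si] y [<-|/si].
Qed.

(** The iterated ultrafilter quantifier: for [U]-almost all i_1, for [U]-almost all i_2, and so on,
    [P] holds of the word i_1 .. i_n. *)
Fixpoint ultraQ (n : nat) (P : seq nat -> Prop) : Prop :=
  if n is m.+1 then U [set i | ultraQ m (fun s => P (i :: s))] else P [::].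

Fixpoint words (t : seq nat) (n : nat) : seq (seq nat) :=
  if n is m.+1 then [::] :: flatten [seq [seq i :: w | w <- words t m] | i <- t]
  else [:: [::]].

Lemma In_words t n w : {subset w <= t} -> (size w <= n)%N -> List.In w (words t n).
Proof.
elim: n w => [|n IH] [|i w] //= wt; first by left.
  by left.
rewrite ltnS => sw; right.
have {}IH : List.In w (words t n).
  by apply: IH => // j jw; apply: wt; rewrite inE jw orbT.
have : i \in t by apply: wt; rewrite mem_head.
move: {wt}(words t n) IH => ws IH.
elim: t => //= j t' IHt; rewrite inE => /orP[/eqP<-|/IHt ?]; apply/List.in_or_app.
  by left; apply/List.in_map_iff; exists w.
by right.
Qed.

(** [A s] collects the [i] whose appending to [s] preserves the truth of the remaining iterated
    quantifier. It belongs to [U], as [U] decides every set, so [h] can be built greedily inside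
    these sets. *)
Lemma ramsey_ultra (n : nat) (P : seq nat -> Prop) :
  exists2 h, increasing h & forall s, sorted ltn s -> size s = n ->
    P (map h s) <-> ultraQ n P.
Proof.
pose A s := [set i | ultraQ (n - size s) (fun r => P (s ++ r)) <->
                     ultraQ (n - size s).-1 (fun r => P (rcons s i ++ r))].
have UA s : (size s < n)%N -> U (A s).
  rewrite -subn_gt0 /A; case: (n - size s)%N => // m _ /=.
  set X := [set i | ultraQ m _].
  have [UX|UX] := in_ultra_setVsetC X ultraU; apply: filterS (UX) => i Xi /=.
    split=> // _; move: Xi; rewrite /X /=; congr ultraQ.
    by apply/funext => r; rewrite cat_rcons.
  split=> [UX'|].
    by case: (filter_not_empty U); apply: filterS (filterI UX UX') => j [].
  rewrite -[ultraQ _ _]/(_ : Prop) => Q; case: Xi; rewrite /X /=.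
  by move: Q; congr ultraQ; apply/funext => r; rewrite cat_rcons.
(* Only finitely many short words over the values [t] chosen so far have to be respected, so the
   intersection of their sets [A s] is still in [U]. *)
have /choice[next nextP] : forall t : seq nat, exists i, (forall j, j \in t -> (j < i)%N) /\
    forall s, {subset s <= t} -> (size s < n)%N -> A s i.
  move=> t.
  have U1 : U [set i | forall j, List.In j t -> (j < i)%N].
    by apply: (@near_all _ t (fun j => [set i | (j < i)%N])) => j _; apply: evU; exists j.+1.
  have U2 : U [set i | forall s, List.In s (words t n) -> (size s < n)%N -> A s i].
    apply: (@near_all _ _ (fun s => [set i | (size s < n)%N -> A s i])) => s _.
    have [sn|sn] := pselect (size s < n)%N.
      by apply: filterS (UA s sn) => i Ai _.
    by apply: filterS filterT => i _ /sn.
  have [i [Hi1 Hi2]] := filter_ex (filterI U1 U2); exists i; split=> [j jt|s st sn].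
    apply: Hi1; elim: t jt {U1 U2 Hi2} => //= k t IH.
    by rewrite inE => /orP[/eqP->|/IH]; [left|right].
  by apply: Hi2 => //; apply: In_words => //; apply: ltnW.
pose t := fix t k := if k is m.+1 then rcons (t m) (next (t m)) else [::].
pose h k := next (t k).
have ht i j : (i < j)%N -> h i \in t j.
  elim: j => // j IH; rewrite ltnS leq_eqVlt /= mem_rcons inE.
  by move=> /orP[/eqP->|/IH->]; rewrite ?eqxx ?orbT.
exists h => [i j /ht|s]; first exact: (nextP (t j)).1.
(* Every increasing prefix, extended by the quantifiers still missing, has the truth value of
   [ultraQ n P]; the full word is the case without quantifiers. *)
suff H m : sorted ltn s -> (size s <= n)%N -> m = (n - size s)%N ->
    ultraQ m (fun r => P (map h s ++ r)) <-> ultraQ n P.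
  by move=> ss sn; rewrite -(H 0) ?sn ?subnn //= cats0.
elim/last_ind: s m => [|s j IH] m; first by rewrite subn0 => _ _ ->.
rewrite map_rcons size_rcons => ss sn ->.
have [ss' sj] : sorted ltn s /\ forall i, i \in s -> (i < j)%N.
  move: ss; rewrite -cats1 (sorted_pairwise ltn_trans) pairwise_cat.
  rewrite (sorted_pairwise ltn_trans) => /and3P[/allrelP sj -> _]; split=> // i si.
  by apply: sj => //; rewrite inE.
rewrite -(IH (n - size s)%N) 1?ltnW //.
have [_ /(_ (map h s))] := nextP (t j); rewrite /A /= size_map => -[].
- by move=> _ /mapP[i /sj ij ->]; apply: ht.
- by [].
- by rewrite subnS => H1 H2; split.
Qed.

End Ultra.

Lemma ramsey (n : nat) (P : seq nat -> Prop) :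
  exists2 h, increasing h & forall s s', sorted ltn s -> sorted ltn s' ->
    size s = n -> size s' = n -> P (map h s) <-> P (map h s').
Proof.
have [U [ultraU evU]] := ultraFilterLemma eventually_filter.
have [h inch hP] := ramsey_ultra ultraU evU n P.
exists h => // s s' ss ss' sn sn'.
exact: iff_trans (hP s ss sn) (iff_sym (hP s' ss' sn')).
Qed.

Lemma ramsey_seq (T : Type) (D : seq T) (n : T -> nat) (P : T -> seq nat -> Prop) :
  exists2 h, increasing h & forall x, List.In x D -> forall s s',
    sorted ltn s -> sorted ltn s' -> size s = n x -> size s' = n x ->
    P x (map h s) <-> P x (map h s').
Proof.
elim: D => [|x D [h inch hP]]; first by exists id.
have [k inck kP] := ramsey (n x) (fun s => P x (map h s)).
have sk s : sorted ltn s -> sorted ltn (map k s).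
  by apply: homo_sorted.
exists (h \o k); first exact: increasing_comp.
move=> y [<-|yD] s s' ss ss' sn sn'; rewrite (map_comp h k s) (map_comp h k s'); first exact: kP.
by apply: hP; rewrite ?size_map //; apply: sk.
Qed.

End Ramsey.

(** * Indiscernible sequences *)

Section Indiscernible.
Variables (L : language) (C : structure L).
Implicit Types P V W : Type.

Definition cas (P W X : Type) (b : P -> X) (w : W -> X) (z : P + W) : X :=
  match z with inl p => b p | inr y => w y end.

Definition sub V W X (u : nat * W -> X) (g : V -> nat) (z : V * W) : X :=
  u (g z.1, z.2).

Definition row W (u : nat * W -> C) (i : nat) (w : W) : C := u (i, w).

(** Parameters are an indexed family [b] instead of a set, and increasing maps on all of [nat]
    replace increasing tuples of every length: a formula sees only finitely many rows. *)
Definition indisc P W (b : P -> C) (u : nat * W -> C) := forall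
  (phi : formula L (P + nat * W)) (g g' : nat -> nat),
  increasing g -> increasing g' ->
  sat phi (cas b (sub u g)) <-> sat phi (cas b (sub u g')).

(** Only the order pattern of the occurring row indices matters: replace each index by its rank [r]
    among the values of [G]; then [G] and [G'] both factor through [r] and increasing maps, to which
    [indisc] applies. *)
Lemma indisc_order P V W (b : P -> C) (u : nat * W -> C)
    (phi : formula L (P + V * W)) (G G' : V -> nat) :
  indisc b u ->
  (forall x y w w', occ phi (inr (x, w)) -> occ phi (inr (y, w')) ->
    (G x < G y)%N = (G' x < G' y)%N) ->
  sat phi (cas b (sub u G)) -> sat phi (cas b (sub u G')).
Proof.
move=> indu GG'.
have [l lP] : exists l : seq V,
    forall x, (exists w, occ phi (inr (x, w))) <-> List.In x l.
  exact: listed_exact (listed_fst (listed_inr (listed_occ phi))).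
have {}GG' x y : List.In x l -> List.In y l -> (G x < G y)%N = (G' x < G' y)%N.
  by move=> /lP[w ow] /lP[w' ow']; apply: GG' ow ow'.
pose S := sort leq (undup (map G l)); pose M := size S.
have Sl i : (i < M)%N -> exists2 x, List.In x l & G x = nth 0 S i.
  move=> iM; have : nth 0 S i \in map G l.
    by rewrite -mem_undup -(mem_sort leq) mem_nth.
  elim: (l) => //= x l' IH; rewrite inE => /orP[/eqP->|/IH[y yl <-]].
    by exists x => //; left.
  by exists y => //; right.
have lS x : List.In x l -> G x \in S.
  rewrite mem_sort mem_undup; elim: (l) => //= y l' IH [->|/IH xl].
    by rewrite mem_head.
  by rewrite inE xl orbT.
have incS i j : (i < j < M)%N -> (nth 0 S i < nth 0 S j)%N.
  move=> /andP[ij jM]; apply: (sorted_ltn_nth ltn_trans) => //.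
    rewrite ltn_sorted_uniq_leq sort_uniq undup_uniq /=.
    exact: (sort_sorted leq_total).
  exact: ltn_trans ij jM.
(* [f i] is the value of [G'] at a variable where [G] takes its [i]-th value; beyond [M] it is the
   default 0, to be corrected by [increasing_extend]. *)
have /choice[f fP] : forall i, exists m, (i < M)%N ->
    exists x, [/\ List.In x l, G x = nth 0 S i & m = G' x].
  move=> i; case: (boolP (i < M)%N) => [/Sl[x xl Gx]|_]; last by exists 0.
  by exists (G' x) => _; exists x.
have [g incg gP] := increasing_extend incS.
have [i j ijM|g' incg' gP'] := @increasing_extend f M.
  have /andP[ij jM] := ijM; have iM := ltn_trans ij jM.
  have [x [xl Gx ->]] := fP i iM; have [y [yl Gy ->]] := fP j jM.
  by rewrite -GG' // Gx Gy; apply: incS.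
pose r x := index (G x) S.
pose psi := rename (fun z : P + V * W =>
  match z with inl p => inl p | inr xw => inr (r xw.1, xw.2) end) phi.
have rM x : List.In x l -> (r x < M)%N by move=> /lS; rewrite index_mem.
have [H _] := indu psi g g' incg incg'.
move=> sphi; have /H : sat psi (cas b (sub u g)).
  apply/sat_rename; apply: sat_extW sphi => -[p|[x w]] //= ox.
  have xl : List.In x l by apply/lP; exists w.
  by rewrite /sub /= gP ?rM // nth_index // lS.
move=> /sat_rename; apply: sat_extW => -[p|[x w]] //= ox.
have xl : List.In x l by apply/lP; exists w.
rewrite /sub /= gP' ?rM //; congr (u (_, _)).
have [y [yl Gy ->]] := fP _ (rM x xl).
have {}Gy : G y = G x by rewrite Gy nth_index // lS.
by case: (ltngtP (G' y) (G' x)); rewrite -?GG' // Gy ltnn.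
Qed.

Lemma indisc_shift P W (b : P -> C) (u : nat * W -> C) (m : nat) :
  indisc b u -> indisc b (sub u (addn m)).
Proof.
move=> indu phi g g' incg incg'.
by apply: (indu phi (addn m \o g) (addn m \o g'));
  apply: increasing_comp => //; apply: increasing_addl.
Qed.

Lemma indisc_params P Q W (b : P -> C) (h : Q -> P) (u : nat * W -> C) :
  indisc b u -> indisc (b \o h) u.
Proof.
move=> indu phi g g' incg incg'.
pose k (z : Q + nat * W) : P + nat * W :=
  match z with inl q => inl (h q) | inr x => inr x end.
have E u' : cas (b \o h) u' = cas b u' \o k by apply/funext => -[].
rewrite !E -!sat_rename; exact: indu.
Qed.

End Indiscernible.

(** * Extending elementary maps *)

Section Extension.
Variables (kbar : Type) (L : language) (T : set (sentence L)) (C : structure L).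
Hypothesis mon : monster kbar T C.

(** Tuples [v] and [v'] of the same type admit corresponding extensions. For finitely many formulas,
    quantify existentially over the variables of [a] and transfer the result from [v] to [v'];
    compactness does the rest. *)
Lemma elementary_extension (V W : Type) (v v' : V -> C) (a : W -> C) :
  small kbar (V + W) ->
  (forall phi : formula L V, sat phi v -> sat phi v') ->
  exists a' : W -> C, forall phi : formula L (V + W),
    sat phi (cas v a) <-> sat phi (cas v' a').
Proof.
move=> sVW vv'; have [[v0]|V0] := pselect (inhabited V); last first.
  by exists a => phi; rewrite (_ : v = v') //; apply/funext => x; case: V0.
pose G : set (formula L (V + W)) := [set phi | sat phi (cas v a)].
pose W0 : set (V + W) := [set z | exists x, z = inl x].
have [F FG|c [cW0 cG]] := compactness mon sVW (W0 := W0) (f0 := cas v' a) (Gamma := G).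
  have [s sP] := listed_inr (listed_occ (Conj F)).
  pose psi := foldr (@Ex L (V + W)) (Conj F) (map inr s).
  pose h (z : V + W) := match z with inl x => x | inr _ => v0 end.
  have /sat_rename : sat (rename h psi) v'.
    apply: vv'; apply/sat_rename.
    have : sat psi (cas v a).
      by apply/sat_foldr_Ex; exists (cas v a) => //; apply/sat_Conj.
    apply: sat_extW => -[x //|y] oy.
    have [oy' []] := occ_foldr_Ex oy.
    by apply/In_map; exists y; split=> //; apply: sP.
  move=> spsi; have : sat psi (cas v' a).
    apply: sat_extW spsi => -[x //|y] oy.
    have [oy' []] := occ_foldr_Ex oy.
    by apply/In_map; exists y; split=> //; apply: sP.
  move=> /sat_foldr_Ex[w wE /sat_Conj wF]; exists w; split=> // _ [x ->].
  by apply: wE => /In_map[y [//]].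
have E : c = cas v' (c \o inr).
  by apply/funext => -[x|y] //=; rewrite cW0 //; exists x.
exists (c \o inr) => phi; rewrite -E; split=> [/cG//|sc].
by apply: contrapT => n; have /= := cG (Neg phi) n.
Qed.

End Extension.

(** * Shattering and indiscernibility *)

Section Shattering.
Variables (kbar : Type) (L : language) (T : set (sentence L)) (C : structure L).
Hypothesis mon : monster kbar T C.
Implicit Types P W : Type.

Lemma compactness_params P X (b : P -> C) (Gamma : set (formula L (P + X))) :
  small kbar (P + X) ->
  (forall F : seq (formula L (P + X)), (forall phi, List.In phi F -> Gamma phi) ->
    exists x : X -> C, forall phi, List.In phi F -> sat phi (cas b x)) ->
  exists x : X -> C, forall phi, Gamma phi -> sat phi (cas b x).
Proof.
move=> sPX finsat; have [c0] := carrier_inh C.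
have [F FG|v [vb vG]] := compactness mon sPX (W0 := [set z | exists p, z = inl p])
    (f0 := cas b (fun=> c0)) (Gamma := Gamma).
  by have [x xF] := finsat F FG; exists (cas b x); split=> // _ [p ->].
exists (v \o inr) => phi /vG; congr sat.
by apply/funext => -[p|x] //=; rewrite vb //; exists p.
Qed.

Definition real P W (b : P -> C) (Y : set (formula L (P + W))) (w : W -> C) :=
  forall phi, Y phi -> sat phi (cas b w).

Definition smap (X X' Y Y' : Type) (f : X -> X') (g : Y -> Y') (z : X + Y) : X' + Y' :=
  match z with inl x => inl (f x) | inr y => inr (g y) end.

Definition lift_type P Q W (Y : set (formula L (P + W))) : set (formula L ((P + Q) + W)) :=
  [set rename (smap inl id) phi | phi in Y].

Lemma real_lift P Q W (b : P -> C) (q : Q -> C) Y (w : W -> C) :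
  real (cas b q) (lift_type (Q := Q) Y) w <-> real b Y w.
Proof.
have E : cas (cas b q) w \o smap inl id = cas b w by apply/funext => -[].
split=> [H phi Yphi|H _ [phi Yphi <-]]; last by apply/sat_rename; rewrite E; apply: H.
have /sat_rename : sat (rename (smap inl id) phi) (cas (cas b q) w).
  by apply: H; exists phi.
by rewrite E.
Qed.

(* The independence property of [th] over [b], restricted to realizations of [Y1]
   and to sequences of realizations of [Y2] (only finitely many entries of each
   sequence occur in [th]). *)
Definition shatters P W1 W2 (b : P -> C) (Y1 : set (formula L (P + W1)))
    (Y2 : set (formula L (P + W2))) (th : formula L ((P + W1) + nat * W2)) :=
  exists d : nat -> nat * W2 -> C,
    (forall l i, real b Y2 (row (d l) i)) /\
    forall s : nat -> Prop, exists c : W1 -> C, real b Y1 c /\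
      forall l, sat th (cas (cas b c) (d l)) <-> s l.

(** The dual of shattering: one fixed instance [e], and a sequence [u] along which the truth of [th]
    follows the parity of the index. *)
Definition alternates P W1 W2 (b : P -> C) (Y1 : set (formula L (P + W1)))
    (Y2 : set (formula L (P + W2))) (th : formula L ((P + W1) + nat * W2))
    (e : nat * W2 -> C) (u : nat * W1 -> C) :=
  [/\ forall i, real b Y2 (row e i), forall j, real b Y1 (row u j)
    & forall j, sat th (cas (cas b (row u j)) e) <-> ~~ odd j].

(* [u] is indiscernible over [b] but [c] destroys this on every end segment with
   even starting point, and does so through finitely many formulas. *)
Definition broken P W1 W2 (b : P -> C) (Y1 : set (formula L (P + W1)))
    (Y2 : set (formula L (P + W2))) :=
  exists (c : W1 -> C) (u : nat * W2 -> C)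
    (D : seq (formula L ((P + W1) + nat * W2) * ((nat -> nat) * (nat -> nat)))),
    [/\ real b Y1 c, forall j, real b Y2 (row u j), indisc b u,
        forall x, List.In x D -> increasing x.2.1 /\ increasing x.2.2
      & forall m, exists2 x, List.In x D &
          ~ (sat x.1 (cas (cas b c) (sub u (addn m.*2 \o x.2.1))) <->
             sat x.1 (cas (cas b c) (sub u (addn m.*2 \o x.2.2))))].

Section Types.
Variables (P W1 W2 : Type) (b : P -> C) (Y1 : set (formula L (P + W1)))
  (Y2 : set (formula L (P + W2))) (th : formula L ((P + W1) + nat * W2)).
Implicit Types (e : nat * W2 -> C) (u : nat * W1 -> C).

Let X := (nat * W2 + nat * W1)%type.

Definition alt_var (j : nat) (z : (P + W1) + nat * W2) : P + X :=
  match z with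
  | inl (inl p) => inl p
  | inl (inr w) => inr (inr (j, w))
  | inr x => inr (inl x)
  end.

(** Expresses [alternates] as a partial type in the entries of [e] and [u] together, so that
    compactness can produce both at once. *)
Definition alt_type : set (formula L (P + X)) := fun phi =>
  [\/ exists i psi, Y2 psi /\ phi = rename (smap id (fun w => inl (i, w))) psi,
      exists j psi, Y1 psi /\ phi = rename (smap id (fun w => inr (j, w))) psi
    | exists j, phi = if odd j then Neg (rename (alt_var j) th)
                      else rename (alt_var j) th].

Lemma sat_row2 (psi : formula L (P + W2)) e u i :
  sat (rename (smap id (fun w => inl (i, w))) psi) (cas b (cas e u)) <->
  sat psi (cas b (row e i)).
Proof. by rewrite sat_rename (_ : _ \o _ = cas b (row e i)) //; apply/funext => -[]. Qed.

Lemma sat_row1 (psi : formula L (P + W1)) e u j :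
  sat (rename (smap id (fun w => inr (j, w))) psi) (cas b (cas e u)) <->
  sat psi (cas b (row u j)).
Proof. by rewrite sat_rename (_ : _ \o _ = cas b (row u j)) //; apply/funext => -[]. Qed.

Lemma sat_alt_var e u j :
  sat (rename (alt_var j) th) (cas b (cas e u)) <->
  sat th (cas (cas b (row u j)) e).
Proof.
rewrite sat_rename (_ : _ \o _ = cas (cas b (row u j)) e) //.
by apply/funext => -[[]|].
Qed.

Lemma sat_alt_odd e u j :
  sat (if odd j then Neg (rename (alt_var j) th) else rename (alt_var j) th)
    (cas b (cas e u)) <->
  (sat th (cas (cas b (row u j)) e) <-> ~~ odd j).
Proof.
rewrite -sat_alt_var; case: (odd j) => /=; last by split=> // -[_]; apply.
by split=> [n|[H _] /H//]; split=> // /n.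
Qed.

Lemma sat_alt_type e u :
  (forall phi, alt_type phi -> sat phi (cas b (cas e u))) <->
  alternates b Y1 Y2 th e u.
Proof.
split=> [H|[H2 H1 Ht] phi [[i [psi [Yp ->]]]|[j [psi [Yp ->]]]|[j ->]]].
- split=> [i psi Yp|j psi Yp|j].
  + by apply/(sat_row2 psi e u); apply: H; apply: Or31; exists i, psi.
  + by apply/(sat_row1 psi e u); apply: H; apply: Or32; exists j, psi.
  + by apply/sat_alt_odd; apply: H; apply: Or33; exists j.
- by apply/sat_row2; apply: H2.
- by apply/sat_row1; apply: H1.
- by apply/sat_alt_odd.
Qed.

Section Ind.
Variables (Q : Type) (q : Q -> P + nat * W2).

Definition ind_var (g : nat -> nat) (z : Q + nat * W1) : P + X :=
  match z with
  | inl x => match q x with inl p => inl p | inr y => inr (inl y) end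
  | inr x => inr (inr (g x.1, x.2))
  end.

(** Expresses as a partial type that [u] is indiscernible over the parameters selected by [q], which
    may be entries of the unknown [e] as well as values of [b]. *)
Definition ind_type : set (formula L (P + X)) := fun phi =>
  exists (psi : formula L (Q + nat * W1)) g g', [/\ increasing g, increasing g'
    & phi = Iff (rename (ind_var g) psi) (rename (ind_var g') psi)].

Lemma sat_ind_var (psi : formula L (Q + nat * W1)) g e u :
  sat (rename (ind_var g) psi) (cas b (cas e u)) <->
  sat psi (cas (cas b e \o q) (sub u g)).
Proof.
rewrite sat_rename (_ : _ \o _ = cas (cas b e \o q) (sub u g)) //.
by apply/funext => -[x|[]] //=; case: (q x).
Qed.

Lemma sat_ind_type e u :
  (forall phi, ind_type phi -> sat phi (cas b (cas e u))) <->
  indisc (cas b e \o q) u.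
Proof.
split=> [H psi g g' ig ig'|H _ [psi [g [g' [ig ig' ->]]]]].
  rewrite -!sat_ind_var; apply/sat_Iff; apply: H; by exists psi, g, g'.
by apply/sat_Iff; rewrite !sat_ind_var; apply: H.
Qed.

End Ind.
End Types.

Lemma occ_row_bound P W (phi : formula L (P + nat * W)) :
  exists M, forall i w, occ phi (inr (i, w)) -> (i < M)%N.
Proof.
have [s sP] := listed_fst (listed_inr (listed_occ phi)).
by have [M MP] := list_bound id s; exists M => i w o; apply: MP; apply: sP; exists w.
Qed.

(** A formula [psi] depends on its first [n psi] rows only, so it is a property of increasing words
    of that length and Ramsey's theorem applies. *)
Lemma ramsey_indisc P W (b : P -> C) (u : nat * W -> C)
    (D : seq (formula L (P + nat * W))) :
  exists2 h, increasing h & forall psi, List.In psi D ->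
    forall g g', increasing g -> increasing g' ->
    sat psi (cas b (sub u (h \o g))) <-> sat psi (cas b (sub u (h \o g'))).
Proof.
have /choice[n nP] : forall psi : formula L (P + nat * W), exists n,
    forall i w, occ psi (inr (i, w)) -> (i < n)%N.
  exact: occ_row_bound.
have [h inch hP] := ramsey_seq D n (fun psi s => sat psi (cas b (sub u (nth 0 s)))).
have srt g k : increasing g -> sorted ltn (mkseq g k).
  move=> ig; apply: (homo_sorted (e := ltn)) => //; exact: iota_ltn_sorted.
have E psi g : sat psi (cas b (sub u (h \o g))) <->
    sat psi (cas b (sub u (nth 0 (map h (mkseq g (n psi)))))).
  apply: sat_ext => -[p|[i w]] //= /nP iM.
  by rewrite /sub /= (nth_map 0) ?size_mkseq // nth_mkseq.
exists h => // psi pD g g' ig ig'; rewrite !E; apply: hP => //; rewrite ?size_mkseq //;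
  exact: srt.
Qed.

(** After the exchange of sides, every finite set of indices [j] is cut out of the sequence [c] by
    some [d l]. Thin out [c] by Ramsey's theorem, cut out the terms at even places, and pass to the
    limit by compactness. *)
Lemma shatters_alternates P W1 W2 (b : P -> C) (Y1 : set (formula L (P + W1)))
    (Y2 : set (formula L (P + W2))) (th : formula L ((P + W1) + nat * W2)) :
  small kbar P -> small kbar W1 -> small kbar W2 -> shatters b Y1 Y2 th ->
  exists e u, alternates b Y1 Y2 th e u /\ indisc b u.
Proof.
move=> sP sW1 sW2 [d [dY2 dc]].
have lim := monster_strong_limit mon; have sN := small_nat mon.
pose dec l : seq nat := odflt [::] (unpickle l).
(* Read the index of [d l] as a finite set of naturals: this exchanges the two
   sides of the shattering. *)
have /choice[c cP] : forall j, exists c, real b Y1 c /\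
    forall l, sat th (cas (cas b c) (d l)) <-> j \in dec l by move=> j; apply: dc.
pose cc (z : nat * W1) := c z.1 z.2.
pose G := alt_type Y1 Y2 th `|` ind_type (W1 := W1) (W2 := W2) (@inl P (nat * W2)).
have [||x xG] := @compactness_params P (nat * W2 + nat * W1) b G; last first.
- exists (x \o inl), (x \o inr).
  have E : x = cas (x \o inl) (x \o inr) by apply/funext => -[].
  split.
    by apply/sat_alt_type => phi aphi; rewrite -E; apply: xG; left.
  have -> : b = cas b (x \o inl) \o inl by apply/funext.
  by apply/sat_ind_type => phi iphi; rewrite -E; apply: xG; right.
- move=> F FG.
  (* What [phi] demands: [D.1] is to be made homogeneous by Ramsey's theorem, and [D.2] bounds the
     indices where parity matters. [Bot] and 0 stand for an empty demand. *)
  pose R phi (D : formula L (P + nat * W1) * nat) := forall h e,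
    (forall g g', increasing g -> increasing g' ->
      sat D.1 (cas b (sub cc (h \o g))) <-> sat D.1 (cas b (sub cc (h \o g')))) ->
    (forall j, (j < D.2)%N -> sat th (cas (cas b (c (h j))) e) <-> ~~ odd j) ->
    (forall i, real b Y2 (row e i)) ->
    sat phi (cas b (cas e (sub cc h))).
  have [phi /FG|t [Ft _]] := @list_choice _ _ R F.
    case=> [[[i [psi [Yp ->]]]|[j [psi [Yp ->]]]|[j ->]]|].
    + by exists (Bot L _, 0) => h e _ _ H; apply/sat_row2; apply: H.
    + by exists (Bot L _, 0) => h e _ _ _; apply/sat_row1; apply: (cP (h j)).1.
    + by exists (Bot L _, j.+1) => h e _ H _; apply/sat_alt_odd; apply: H.
    + move=> [psi [g [g' [ig ig' ->]]]]; exists (psi, 0) => h e H _ _.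
      by apply/sat_Iff; rewrite !sat_ind_var; apply: (H g g').
  have [h inch hP] := ramsey_indisc b cc (map fst t).
  have [M MP] := list_bound id (map snd t).
  (* The terms at even places below [M]; since [dec] inverts [pickle], the instance [d (pickle s)]
     alternates along [h] up to [M]. *)
  pose s := [seq h j | j <- iota 0 M & ~~ odd j].
  exists (cas (d (pickle s)) (sub cc h)) => phi /Ft[D Dt]; apply=> [|j jD|i].
  + by apply: hP; apply/In_map; exists D.
  + rewrite (cP (h j)).2 /dec pickleK /=.
    have jM : (j < M)%N.
      by apply: ltn_trans jD (MP _ _); apply/In_map; exists D.
    have injh : injective h.
      by move=> x y E; case: (ltngtP x y) => // /inch; rewrite E ltnn.
    by rewrite mem_map // mem_filter mem_iota /= add0n jM andbT.
  + exact: dY2.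
- do 2?[apply: small_sum => //]; exact: small_prod.
Qed.

Lemma ex_last (Q : nat -> Prop) (r : nat) :
  Q 0 -> ~ Q r -> exists k, Q k /\ ~ Q k.+1.
Proof.
elim: r => // r IH Q0 nQ; have [Qr|nQr] := pselect (Q r); first by exists r.
exact: IH.
Qed.

Lemma alternates_shift P W1 W2 (b : P -> C) (Y1 : set (formula L (P + W1)))
    (Y2 : set (formula L (P + W2))) (th : formula L ((P + W1) + nat * W2)) e u m :
  alternates b Y1 Y2 th e u -> alternates b Y1 Y2 th e (sub u (addn m.*2)).
Proof.
move=> [H2 H1 Ht]; split=> // j; first exact: (H1 (m.*2 + j)%N).
have -> : odd j = odd (m.*2 + j) by rewrite oddD odd_double.
exact: (Ht (m.*2 + j)%N).
Qed.

(** Take [k] last such that an alternating pair exists with [u'] indiscernible over the first [k]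
    rows of [e']. Row [k] then breaks indiscernibility on every even shift, and compactness makes
    finitely many formulas responsible for all of them. *)
Lemma alternates_broken P W1 W2 (b : P -> C) (Y1 : set (formula L (P + W1)))
    (Y2 : set (formula L (P + W2))) (th : formula L ((P + W1) + nat * W2)) e u :
  small kbar P -> small kbar W1 -> small kbar W2 ->
  alternates b Y1 Y2 th e u -> indisc b u ->
  exists k (q : 'I_k * W2 -> C), broken (cas b q) (lift_type Y2) (lift_type Y1).
Proof.
move=> sP sW1 sW2 alt0 ind0.
have lim := monster_strong_limit mon; have sN := small_nat mon.
pose q k (z : P + 'I_k * W2) : P + nat * W2 :=
  smap id (fun x => (nat_of_ord x.1, x.2)) z.
pose good k e' u' := alternates b Y1 Y2 th e' u' /\ indisc (cas b e' \o q k) u'.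
have good0 : good 0 e u.
  split=> //; pose h (z : P + 'I_0 * W2) : P := match z with
    inl p => p | inr x => match x.1 with Ordinal m lt => match notF lt with end end end.
  have -> : cas b e \o q 0 = b \o h by apply/funext => -[|[[]]].
  exact: indisc_params.
have [r rP] := occ_row_bound th.
(* If [u'] were indiscernible over all rows of [e'] that occur in [th], rows 0 and 1 of [u'] would
   agree on [th]. The bound is [r.+1] so that [inord] has a nonempty target. *)
have ngood e' u' : ~ good r.+1 e' u'.
  move=> [[_ _ Ht] ind].
  pose h (z : (P + W1) + nat * W2) : (P + 'I_r.+1 * W2) + nat * W1 := match z with
    | inl (inl p) => inl (inl p) | inl (inr w) => inr (0, w)
    | inr x => inl (inr (inord x.1, x.2)) end.
  have E g : sat (rename h th) (cas (cas b e' \o q r.+1) (sub u' g)) <->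
      sat th (cas (cas b (row u' (g 0))) e').
    rewrite sat_rename; apply: sat_ext => -[[p|w]|[i w]] //= /rP ir.
    by rewrite inordK // ltnS ltnW.
  have := ind (rename h th) id succn increasing_id (fun i j => id).
  by rewrite !E !Ht /= => -[/(_ isT)].
have [k [[e1 [u1 [alt1 ind1]]] ngoodk]] : exists k,
    (exists e' u', good k e' u') /\ ~ (exists e' u', good k.+1 e' u').
  apply: (@ex_last _ r.+1); first by exists e, u.
  by move=> [e' [u' /ngood]].
pose Q := ((P + 'I_k * W2) + W2)%type.
(* The parameters of [q k] together with row [k] of [e]; over these, indiscernibility must fail. *)
pose qq (z : Q) : P + nat * W2 := cas (q k) (fun w => inr (k, w)) z.
pose G := (alt_type Y1 Y2 th `|` ind_type (W1 := W1) (q k)) `|` ind_type (W1 := W1) qq.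
have nG : ~ exists x : nat * W2 + nat * W1 -> C, forall phi, G phi -> sat phi (cas b x).
  move=> [x xG]; apply: ngoodk; exists (x \o inl), (x \o inr).
  have E : x = cas (x \o inl) (x \o inr) by apply/funext => -[].
  split.
    by apply/sat_alt_type => phi aphi; rewrite -E; apply: xG; left; left.
  have ind : indisc (cas b (x \o inl) \o qq) (x \o inr).
    by apply/sat_ind_type => phi iphi; rewrite -E; apply: xG; right.
  pose h (z : P + 'I_k.+1 * W2) : Q := match z with
    | inl p => inl (inl p)
    | inr x => match unlift ord_max x.1 with
               | Some i => inl (inr (i, x.2)) | None => inr x.2 end end.
  rewrite (_ : _ \o _ = (cas b (x \o inl) \o qq) \o h); first exact: indisc_params.
  apply/funext => -[p|[i w]] //=; case: unliftP => [j ->|->] //=.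
  by rewrite /bump leqNgt ltn_ord.
(* By maximality of [k], the indiscernibility of [u'] over [e'_0 .. e'_k] is
   inconsistent with [good k]; the class [good k] is closed under even shifts. *)
have [D Dinc DP] : exists2 D : seq (formula L (Q + nat * W1) *
      ((nat -> nat) * (nat -> nat))),
    forall x, List.In x D -> increasing x.2.1 /\ increasing x.2.2 &
    forall e' u', good k e' u' -> exists2 x, List.In x D &
      ~ (sat x.1 (cas (cas b e' \o qq) (sub u' x.2.1)) <->
         sat x.1 (cas (cas b e' \o qq) (sub u' x.2.2))).
  apply: contrapT => nD; apply: nG; apply: compactness_params => [|F FG].
    do 2?[apply: small_sum => //]; exact: small_prod.
  (* One instance of indiscernibility that, added to [good k], implies [phi]. Where [good k]
     suffices, the trivial instance [(Bot, (id, id))] is taken. *)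
  pose R phi (x : formula L (Q + nat * W1) * ((nat -> nat) * (nat -> nat))) :=
    [/\ increasing x.2.1, increasing x.2.2 & forall e' u', good k e' u' ->
      (sat x.1 (cas (cas b e' \o qq) (sub u' x.2.1)) <->
       sat x.1 (cas (cas b e' \o qq) (sub u' x.2.2))) ->
      sat phi (cas b (cas e' u'))].
  have [phi /FG|D [FD DF]] := @list_choice _ _ R F.
    case=> [[aphi|iphi]|[psi [g [g' [ig ig' ->]]]]].
    + exists (Bot L _, (id, id)); split=> // e' u' [+ _] _.
      by move=> /sat_alt_type; apply.
    + exists (Bot L _, (id, id)); split=> // e' u' [_ +] _.
      by move=> /sat_ind_type; apply.
    + exists (psi, (g, g')); split=> // e' u' _ H.
      by apply/sat_Iff; rewrite !sat_ind_var.
  apply: contrapT => nF; apply: nD; exists D => [x /DF[phi _ []]//|e' u' ge].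
  apply: contrapT => nx; apply: nF; exists (cas e' u') => phi /FD[x xD [_ _]].
  apply=> //; apply: contrapT => n; apply: nx; by exists x.
exists k, (fun x => e1 (nat_of_ord x.1, x.2)).
have Ek e' : cas b (fun x : 'I_k * W2 => e' (nat_of_ord x.1, x.2)) = cas b e' \o q k.
  by apply/funext => -[].
have Eqq e' : cas (cas b (fun x : 'I_k * W2 => e' (nat_of_ord x.1, x.2))) (row e' k) =
    cas b e' \o qq by apply/funext => -[[]|].
have [a2 a1 _] := alt1.
exists (row e1 k), u1, D; split=> //.
- by apply/real_lift.
- by move=> j; apply/real_lift.
- by rewrite Ek.
- move=> m; rewrite Eqq; apply: (DP e1 (sub u1 (addn m.*2))).
  by split; [exact: alternates_shift|exact: indisc_shift].
Qed.

End Shattering.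

(** * From broken indiscernibility back to shattering *)

Section Duality.
Variables (kbar : Type) (L : language) (T : set (sentence L)) (C : structure L).
Hypothesis mon : monster kbar T C.

Lemma list_pigeonhole (X : Type) (D : seq X) (R : X -> nat -> Prop) :
  (forall n, exists2 x, List.In x D & R x n) ->
  exists2 x, List.In x D & forall N, exists2 n, (N <= n)%N & R x n.
Proof.
move=> DR; apply: contrapT => nD.
have [x xD|t [Dt _]] := @list_choice _ _ (fun x N => forall n, (N <= n)%N -> ~ R x n) D.
  apply: contrapT => nN; apply: nD; exists x => // N; apply: contrapT => nn.
  by apply: nN; exists N => n Nn Rn; apply: nn; exists n.
have [M MP] := list_bound id t; have [x xD Rx] := DR M.
by have [N Nt /(_ M)] := Dt x xD; apply=> //; apply/ltnW/MP.
Qed.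

(** One formula and one pair [g], [g'] fail at infinitely many starting points. In widely spaced
    blocks, choosing [g] or [g'] in each realizes any pattern of truth values with the same [c]. All
    choices have the same order type, so [c] can be moved to work for a fixed choice. *)
Lemma broken_shatters P W1 W2 (b : P -> C) (Y1 : set (formula L (P + W1)))
    (Y2 : set (formula L (P + W2))) :
  small kbar P -> small kbar W1 -> small kbar W2 -> broken b Y1 Y2 ->
  exists th, shatters b Y1 Y2 th.
Proof.
move=> sP sW1 sW2 [c [u [D [cY1 uY2 indu Dinc Dfail]]]].
have lim := monster_strong_limit mon; have sN := small_nat mon.
pose S (phi : formula L ((P + W1) + nat * W2)) g m :=
  sat phi (cas (cas b c) (sub u (addn m.*2 \o g))).
(* Exchanging [g] and [g'] orients each failure: true at the first, false at the second. *)
pose swap (x : formula L ((P + W1) + nat * W2) * ((nat -> nat) * (nat -> nat))) :=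
  (x.1, (x.2.2, x.2.1)).
have [x xD xinf] : exists2 x, List.In x (D ++ map swap D) & forall N, exists2 m,
    (N <= m)%N & S x.1 x.2.1 m /\ ~ S x.1 x.2.2 m.
  apply: list_pigeonhole => m; have [x xD nx] := Dfail m.
  have [Sx|nSx] := pselect (S x.1 x.2.1 m).
    exists x; first by apply/List.in_or_app; left.
    by split=> // Sx'; apply: nx.
  exists (swap x); first by apply/List.in_or_app; right; apply/In_map; exists x.
  by split=> //=; apply: contrapT => nSx'; apply: nx.
have {xD} [ig ig'] : increasing x.2.1 /\ increasing x.2.2.
  by move/List.in_app_iff: xD => [/Dinc//|/In_map[y [<- /Dinc[]]]].
move: x xinf ig ig' => [phi [g g']] /= xinf ig ig'.
have [M MP] := occ_row_bound phi.
(* [B] exceeds all values of [g] and [g'] up to [M], hence the length of a block. *)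
pose B := (g M + g' M).+1.
have /choice[nx nxP] : forall N, exists m, (N <= m)%N /\ (S phi g m /\ ~ S phi g' m).
  by move=> N; have [m] := xinf N; exists m.
pose n := fix n l := if l is l'.+1 then nx (n l' + B)%N else nx 0.
have nS l : S phi g (n l) /\ ~ S phi g' (n l).
  by case: l => [|l]; [apply: (nxP 0).2|apply: (nxP (n l + B)%N).2].
have nB l l' : (l < l')%N -> (n l + B <= n l')%N.
  elim: l' => // l' IH; rewrite ltnS leq_eqVlt => /orP[/eqP->|/IH nl].
    exact: (nxP (n l' + B)%N).1.
  by apply: leq_trans (nxP (n l' + B)%N).1; apply: leq_trans nl (leq_addr _ _).
(* Place of row [x.2] of block [x.1]. Truncation at [M] keeps the whole block in its range, and
   [phi] sees only rows below [M]. *)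
pose pos (s : nat -> bool) (x : nat * nat) :=
  ((n x.1).*2 + (if s x.1 then g else g') (minn x.2 M))%N.
have posB s x : ((n x.1).*2 <= pos s x < (n x.1).*2 + B)%N.
  rewrite leq_addr ltn_add2l ltnS; case: (s x.1).
    by apply: leq_trans (leq_addr _ _); apply: increasing_leq => //; apply: geq_minr.
  by apply: leq_trans (leq_addl _ _); apply: increasing_leq => //; apply: geq_minr.
have ltE h : increasing h -> forall i j, (h i < h j)%N = (i < j)%N.
  move=> ih i j; case: (ltngtP i j) => [/ih->//|/ih|->]; last by rewrite ltnn.
  by move=> ji; rewrite ltnNge ltnW.
(* Switching between [g] and [g'] in any set of blocks preserves the order. *)
have pos_order s s' x y : (pos s x < pos s y)%N = (pos s' x < pos s' y)%N.
  have bnd s1 x1 y1 : (x1.1 < y1.1)%N -> (pos s1 x1 < pos s1 y1)%N.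
    move=> /nB xy; have := posB s1 x1; have := posB s1 y1; lia.
  case: (ltngtP x.1 y.1) => xy.
  - by rewrite !bnd.
  - by rewrite (leq_gtF (ltnW (bnd s _ _ xy))) (leq_gtF (ltnW (bnd s' _ _ xy))).
  - rewrite /pos -xy !ltn_add2l.
    by case: (s x.1); case: (s' x.1); rewrite !ltE.
pose all1 : nat -> bool := fun=> true.
exists phi, (fun l z => u (pos all1 (l, z.1), z.2)); split=> [l i|s].
  exact: (uY2 (pos all1 (l, i))).
pose sb l : bool := asbool (s l).
pose V := (P + (nat * nat) * W2)%type.
(* [c] has the pattern [s] on the blocks chosen by [sb]; its image [a'] has this pattern on the
   fixed blocks chosen by [all1]. *)
have [||a' aP] := elementary_extension mon c (V := V) (v := cas b (sub u (pos sb)))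
    (v' := cas b (sub u (pos all1))).
- apply: small_sum => //; apply: small_sum => //; apply: small_prod => //.
  exact: small_prod.
- by move=> psi; apply: indisc_order => // *; apply: pos_order.
exists a'; split=> [psi Yp|l].
  pose h (z : P + W1) : V + W1 := smap inl id z.
  have /sat_rename : sat (rename h psi) (cas (cas b (sub u (pos all1))) a').
    by apply/aP/sat_rename; apply: sat_extW (cY1 psi Yp) => -[].
  by apply: sat_extW => -[].
pose h (z : (P + W1) + nat * W2) : V + W1 := match z with
  | inl (inl p) => inl (inl p) | inl (inr w) => inr w
  | inr x => inl (inr ((l, x.1), x.2)) end.
have -> : sat phi (cas (cas b a') (fun z => u (pos all1 (l, z.1), z.2))) <->
    sat (rename h phi) (cas (cas b (sub u (pos all1))) a').
  by rewrite sat_rename; apply: sat_ext => -[[]|].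
rewrite -aP sat_rename.
have E g1 : g1 = (if sb l then g else g') ->
    sat phi (cas (cas b (sub u (pos sb))) c \o h) <-> S phi g1 (n l).
  move=> ->; apply: sat_ext => -[[]|[i w]] //= /MP iM.
  by rewrite /sub /pos /= (minn_idPl (ltnW iM)).
have [S1 S2] := nS l.
rewrite (E _ erefl) /sb; case: asboolP => sl; split=> //.
Qed.

Lemma shatters_broken P W1 W2 (b : P -> C) (Y1 : set (formula L (P + W1)))
    (Y2 : set (formula L (P + W2))) (th : formula L ((P + W1) + nat * W2)) :
  small kbar P -> small kbar W1 -> small kbar W2 -> shatters b Y1 Y2 th ->
  exists k (q : 'I_k * W2 -> C), broken (cas b q) (lift_type Y2) (lift_type Y1).
Proof.
move=> sP sW1 sW2 /(shatters_alternates mon sP sW1 sW2)[e [u [alt ind]]].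
exact: (alternates_broken mon sP sW1 sW2 alt ind).
Qed.

End Duality.

(** * Cutting one sequence into mutually indiscernible blocks *)

Section Blocks.
Variables (kbar : Type) (L : language) (T : set (sentence L)) (C : structure L).
Hypothesis mon : monster kbar T C.

(** Finitely many conditions mention finitely many blocks and positions, and these fit into disjoint
    segments of the given sequence [u], each starting at an even place where [c] breaks
    indiscernibility. Compactness then yields [K] blocks at once. *)
Lemma broken_blocks (K P W1 : Type) (b : P -> C) (Y1 : set (formula L (P + W1)))
    (Y2 : set (formula L (P + unit))) :
  small kbar K -> small kbar P -> small kbar W1 -> broken b Y1 Y2 ->
  exists (a : W1 -> C) (v : K * nat -> C), [/\ real b Y1 a,
    forall (i : K) m (phi : formula L ((P + K * nat) + 'I_m)) (j j' : 'I_m -> nat),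
      (forall k y, occ phi (inl (inr (k, y))) -> k <> i) ->
      (forall x y, (j x < j y)%N = (j' x < j' y)%N) ->
      sat phi (cas (cas b v) (fun x => v (i, j x))) ->
      sat phi (cas (cas b v) (fun x => v (i, j' x)))
    & forall i : K, exists (phi : formula L ((P + W1) + nat * unit)) (g g' : nat -> nat),
      [/\ increasing g, increasing g' &
       ~ (sat phi (cas (cas b a) (fun z => v (i, g z.1))) <->
          sat phi (cas (cas b a) (fun z => v (i, g' z.1))))]].
Proof.
move=> sK sP sW1 [c [u [D [cY1 _ indu Dinc Dfail]]]].
have lim := monster_strong_limit mon; have sN := small_nat mon.
pose X := (W1 + K * nat)%type.
pose bl_var (i : K) m (j : 'I_m -> nat) (z : (P + K * nat) + 'I_m) : P + X :=
  match z with
  | inl (inl p) => inl p | inl (inr y) => inr (inr y) | inr x => inr (inr (i, j x))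
  end.
pose br_var (i : K) (g : nat -> nat) (z : (P + W1) + nat * unit) : P + X :=
  match z with
  | inl (inl p) => inl p | inl (inr w) => inr (inl w) | inr y => inr (inr (i, g y.1))
  end.
pose br i := Neg (Conj [seq Iff (rename (br_var i x.2.1) x.1)
                                (rename (br_var i x.2.2) x.1) | x <- D]).
pose G : set (formula L (P + X)) := fun phi =>
  [\/ exists psi, Y1 psi /\ phi = rename (smap id inl) psi,
      exists i m (psi : formula L ((P + K * nat) + 'I_m)) (j j' : 'I_m -> nat),
        [/\ forall k y, occ psi (inl (inr (k, y))) -> k <> i,
            forall x y, (j x < j y)%N = (j' x < j' y)%N &
            phi = Imp (rename (bl_var i m j) psi) (rename (bl_var i m j') psi)]
    | exists i, phi = br i].
have bl_sat a v i m j psi : sat (rename (bl_var i m j) psi) (cas b (cas a v)) <->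
    sat psi (cas (cas b v) (fun x => v (i, j x))).
  by rewrite sat_rename; apply: sat_ext => -[[]|].
have br_sat a v i g psi : sat (rename (br_var i g) psi) (cas b (cas a v)) <->
    sat psi (cas (cas b a) (fun z => v (i, g z.1))).
  by rewrite sat_rename; apply: sat_ext => -[[]|].
have [||x xG] := @compactness_params _ _ _ _ mon P X b G; last first.
- exists (x \o inl), (x \o inr).
  have E : x = cas (x \o inl) (x \o inr) by apply/funext => -[].
  split=> [psi Yp|i m psi j j' opsi jj' spsi|i].
  + have /sat_rename : sat (rename (smap id inl) psi) (cas b x).
      by apply: xG; apply: Or31; exists psi.
    by apply: sat_extW => -[].
  + have : sat (Imp (rename (bl_var i m j) psi) (rename (bl_var i m j') psi)) (cas b x).
      by apply: xG; apply: Or32; exists i, m, psi, j, j'.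
    by rewrite E /= !bl_sat; apply.
  + have : sat (br i) (cas b x) by apply: xG; apply: Or33; exists i.
    rewrite E => nC; apply: contrapT => nbr; apply: nC; apply/sat_Conj => _ /In_map[y [<- yD]].
    apply/sat_Iff; rewrite !br_sat; apply: contrapT => ny; apply: nbr.
    by exists y.1, y.2.1, y.2.2; have [] := Dinc y yD.
- move=> F FG; have [s sF] := listed_inr (listed_inr (listed_occ (Conj F))).
  (* [f] numbers the occurring blocks, and [N] bounds the occurring positions, so segments of length
     [2 * N] hold them. *)
  have [f fP] := list_separate (map fst s); have [N NP] := list_bound id (map snd s).
  pose pos (y : K * nat) := ((f y.1 * N).*2 + y.2)%N.
  pose v y := u (pos y, tt).
  exists (cas c v) => phi phiF; have osub := sub_occ_Conj phiF.
  case: (FG phi phiF) => [[psi [Yp E]]|[i [m [psi [j [j' [opsi jj' E]]]]]]|[i E]];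
    rewrite {}E in osub *.
  + by apply/sat_rename; apply: sat_extW (cY1 psi Yp) => -[].
  + rewrite [sat _ _]/= !bl_sat.
    pose h (z : (P + K * nat) + 'I_m) : P + (K * nat + 'I_m) * unit := match z with
      | inl (inl p) => inl p | inl (inr y) => inr (inl y, tt) | inr x => inr (inr x, tt) end.
    pose Gf (jj : 'I_m -> nat) (z : K * nat + 'I_m) :=
      match z with inl y => pos y | inr x => pos (i, jj x) end.
    have hE jj : sat psi (cas (cas b v) (fun x => v (i, jj x))) <->
        sat (rename h psi) (cas b (sub u (Gf jj))).
      by rewrite sat_rename; apply: sat_ext => -[[]|].
    rewrite !hE; apply: indisc_order => // y1 y2 [] []; rewrite occ_rename.
    have sP1 y : occ psi (inl (inr y)) -> List.In y s.
      by move=> oy; apply: sF; apply: osub; left; rewrite occ_rename; exists (inl (inr y)).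
    have sP2 x : occ psi (inr x) -> List.In (i, j x) s /\ List.In (i, j' x) s.
      by move=> ox; split; apply: sF; apply: osub; [left|right]; rewrite occ_rename;
        exists (inr x).
    have inK y : List.In y s -> List.In y.1 (map fst s).
      by move=> ys; apply/In_map; exists y.
    have ltN y : List.In y s -> (y.2 < N)%N.
      by move=> ys; apply: NP; apply/In_map; exists y.
    (* Positions in different blocks are compared through [f] alone, so replacing [j] by [j'] inside
       block [i] keeps the order. *)
    have far y x : occ psi (inl (inr y)) -> occ psi (inr x) ->
        ((pos y < pos (i, j x)) = (pos y < pos (i, j' x)))%N /\
        ((pos (i, j x) < pos y) = (pos (i, j' x) < pos y))%N.
      move=> oy /sP2[/[dup] /ltN /= jN /inK /= iK /ltN /= jN'].
      have ys := sP1 y oy; have yN := ltN y ys.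
      have fyi : f y.1 <> f i.
        move=> /(fP _ _ (inK y ys) iK); apply: (opsi _ y.2).
        by rewrite -surjective_pairing.
      rewrite /pos /=; case: (ltngtP (f y.1) (f i)) => // lt;
        have := leq_mul lt (leqnn N); rewrite mulSn; lia.
    move=> [[[p|y]|x] o1 //= [<-]] [[[p|y']|x'] o2 //= [<-]] //=.
    * by case: (far y x' o1 o2).
    * by case: (far y' x o2 o1).
    * by rewrite /pos /= !ltn_add2l.
  + move=> /sat_Conj sC; have [x xD nx] := Dfail (f i * N)%N; apply: nx.
    have /sat_Iff : sat (Iff (rename (br_var i x.2.1) x.1) (rename (br_var i x.2.2) x.1))
        (cas b (cas c v)) by apply: sC; apply/In_map; exists x.
    rewrite !br_sat => H.
    have E (g : nat -> nat) : (fun z : nat * unit => v (i, g z.1)) =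
      sub u (addn (f i * N).*2 \o g) by apply/funext => -[? []].
    by rewrite -!E.
- apply: small_sum => //; apply: small_sum => //; exact: small_prod.
Qed.

End Blocks.

(** * Types of infinite dp-rank *)

Section Independence.
Variables (kbar : Type) (L : language) (T : set (sentence L)) (C : structure L).
Hypothesis mon : monster kbar T C.
Variables (A : set C) (n : nat).

(** If no fiber of [f] contained an infinite sequence, each would embed in [nat], and these
    embeddings together with [f] would embed [X] in [Y * nat]. *)
Lemma infinite_fiber (X Y : Type) (f : X -> Y) :
  ~ injects X (Y * nat) ->
  exists y (i : nat -> X), injective i /\ forall l, f (i l) = y.
Proof.
move=> nXY; apply: contrapT => nfib; apply: nXY.
have /choice[g gP] : forall y, exists g : X -> nat, forall x x',
    f x = y -> f x' = y -> g x = g x' -> x = x'.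
  move=> y; have [[i ii]|[g ig]] := injects_total nat {x | f x = y}.
    case: nfib; exists y, (fun l => sval (i l)); split=> [l l' E|l].
      by apply: ii; move: E; case: (i l) (i l') => x e [x' e'] /= E; apply: eq_exist.
    exact: (svalP (i l)).
  exists (fun x => match pselect (f x = y) with
                   | left e => g (exist _ x e) | right _ => 0 end) => x x' fx fx'.
  by case: pselect => // e; case: pselect => // e' /ig [].
exists (fun x => (f x, g (f x) x)) => x x' [E]; rewrite -E.
exact: (gP (f x)).
Qed.

(* [fl_form] and [fl_name] range over a small type that does not depend on the
   width of [s], so the pigeonhole principle applies to them. *)
Record failure (s : sequence kbar C) (a : 'I_n -> C) := Failure {
  fl_size : nat;
  fl_j : bool -> 'I_fl_size -> Defs.index s;
  fl_var : nat -> 'I_fl_size * width s;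
  fl_form : formula L nat;
  fl_name : nat -> (A + 'I_n) + nat;
  fl_homo : forall t, {homo fl_j t : k l / (k < l)%O};
  fl_sat : forall t, sat (rename fl_name fl_form)
    (cas (cas (fun x : A => val x) a) (subtuple (fl_j t) \o fl_var)) <-> t }.

Arguments fl_j {s a} _ _ _.
Arguments fl_var {s a} _ _.
Arguments fl_sat {s a} _ _.
Arguments fl_homo {s a} _ _.

(** The occurring variables are replaced by their positions in a list [l], which turns the formula
    into a member of [formula L nat]; [name] and [var] recover their meaning. *)
Lemma not_indiscernible_failure (s : sequence kbar C) (a : 'I_n -> C) :
  ~ indiscernible s (A `|` range a) -> exists _ : failure s a, True.
Proof.
move=> /existsNP[m /existsNP[j /existsNP[j' /not_implyP[hj /not_implyP[hj']]]]].
move=> /existsNP[phi nphi].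
have [j1 hj1 [sphi nsphi]] : exists2 j1 : bool -> 'I_m -> Defs.index s,
    (forall t, {homo j1 t : k l / (k < l)%O}) &
    psat phi (subtuple (j1 true)) /\ ~ psat phi (subtuple (j1 false)).
  have [sj|nsj] := pselect (psat phi (subtuple j)).
    exists (fun t => if t then j else j') => [[]//|]; split=> // sj'.
    exact: nphi.
  exists (fun t => if t then j' else j) => [[]//|]; split=> //.
  by apply: contrapT => nsj'; apply: nphi.
(* With no variables for entries of the sequence, [phi] could not distinguish the two tuples;
   otherwise [pt] is a default variable. *)
have [[pt]|noV] := pselect (inhabited ('I_m * width s)); last first.
  by case: nsphi; apply: sat_extW sphi => -[//|z]; case: noV.
have /choice[q qP] : forall x : set_type (A `|` range a), exists q : A + 'I_n,
    cas (fun x : A => val x) a q = val x.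
  move=> x; have [Ax|[i _ <-]] := set_mem (valP x); last by exists (inr i).
  by exists (inl (SigSub (mem_set Ax))).
pose Z := {classic (set_type (A `|` range a) + 'I_m * width s)%type}.
have [l lP] : exists l : seq Z, forall z, occ phi z -> z \in l.
  by have [l lP] := listed_occ phi; exists l => z /lP/(@In_mem _ l z).
pose z0 : Z := inr pt.
pose var y := match nth z0 l y with inr z => z | inl _ => pt end.
pose name y : (A + 'I_n) + nat :=
  match nth z0 l y with inl x => inl (q x) | inr _ => inr y end.
pose psi := rename (fun z : Z => index z l) phi.
have E t : sat (rename name psi)
    (cas (cas (fun x : A => val x) a) (subtuple (j1 t) \o var)) <->
    psat phi (subtuple (j1 t)).
  rewrite !sat_rename; apply: sat_ext => z /lP zl.
  rewrite /= /name nth_index //; case: z zl => [x|z] zl /=; first by rewrite qP.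
  by rewrite /var nth_index.
unshelve eexists (@Failure s a m j1 var psi name hj1 _) => // t.
by rewrite E; case: t.
Qed.

(** Among power-set many failures, infinitely many share formula and names. Each of these sequences
    offers a true and a false tuple, and mutual indiscernibility gives all choices of tuples the
    same type over [A]; so [a] can be moved to realize every pattern over one fixed choice. *)
Lemma independent_shatters (p : set (pformula A 'I_n)) :
  card_lt A [set: kbar] -> independent kbar p ->
  exists th, shatters (fun x : A => val x) p (set0 : set (formula L (A + unit))) th.
Proof.
move=> ltA indep.
have lim := monster_strong_limit mon; have sN := small_nat mon.
have sA : small kbar A := (small_set_type _ _).1 ltA.
pose col := (formula L nat * (nat -> (A + 'I_n) + nat))%type.
have sV : small kbar (A + 'I_n + nat).
  by apply: small_sum => //; apply: small_sum => //; apply: small_ord mon _.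
have scol : small kbar (col * nat).
  apply: small_prod => //; apply: small_prod (monster_language_small mon) _ => //.
  exact: small_fun.
have /existsNP[a /not_implyP[ap /existsNP[I /not_implyP[mutI noI]]]] :=
  indep (set (col * nat)) (lim _ scol).
have failI i : exists _ : failure (I i) a, True.
  by apply: not_indiscernible_failure => ind; apply: noI; exists i.
pose w i : failure (I i) a := sval (cid (failI i)).
have [y [io [injio ioy]]] := infinite_fiber (fun i => (fl_form (w i), fl_name (w i)))
  (@Cantor (col * nat)).
pose phi := rename y.2 y.1.
pose dd (s : nat -> bool) (z : nat * nat) : C :=
  subtuple (fl_j (w (io z.1)) (s z.1)) (fl_var (w (io z.1)) z.2).
have ddP s l : sat phi (cas (cas (fun x : A => val x) a) (fun x => dd s (l, x))) <-> s l.
  have := fl_sat (w (io l)) (s l).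
  by rewrite /phi -(ioy l).
(* Changing the choice in sequence [m] alone: the tuples from the other sequences are parameters in
   [B], over which sequence [m] is indiscernible. *)
have dd1 (psi : formula L (A + nat * nat)) m s s' : (forall l, l <> m -> s l = s' l) ->
    sat psi (cas (fun x : A => val x) (dd s)) ->
    sat psi (cas (fun x : A => val x) (dd s')).
  move=> ss'.
  pose B : set C := A `|` \bigcup_(j in [set~ io m]) elements (I j).
  have BA (x : A) : B (val x) by left; apply: set_mem (valP x).
  have Bdd z : z.1 <> m -> B (dd s z).
    move=> zm; right; exists (io z.1); first by move=> /injio.
    by eexists; eexists; reflexivity.
  pose h (x : A + nat * nat) : B + 'I_(fl_size (w (io m))) * width (I (io m)) :=
    match x with
    | inl x => inl (SigSub (mem_set (BA x)))
    | inr z => match pselect (z.1 <> m) with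
               | left zm => inl (SigSub (mem_set (Bdd z zm)))
               | right _ => inr (fl_var (w (io m)) z.2) end
    end.
  have hE s1 : (forall l, l <> m -> s l = s1 l) ->
      psat (rename h psi : pformula B _) (subtuple (fl_j (w (io m)) (s1 m))) <->
      sat psi (cas (fun x : A => val x) (dd s1)).
    move=> ss1; rewrite /psat sat_rename; apply: sat_ext => -[x //|[l x] _] /=.
    case: pselect => /= [lm|/contrapT ->//]; by rewrite /dd /= ss1.
  move=> /(hE s (fun _ _ => erefl)) spsi; apply/(hE s' ss').
  have [H _] := mutI (io m) _ _ _ (fl_homo (w (io m)) (s m)) (fl_homo (w (io m)) (s' m))
    (rename h psi).
  exact: H.
have ddE (psi : formula L (A + nat * nat)) s s' :
    sat psi (cas (fun x : A => val x) (dd s)) ->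
    sat psi (cas (fun x : A => val x) (dd s')).
  move=> spsi; have [M MP] := occ_row_bound psi.
  (* Pass from [s] to [s'] one sequence at a time; [psi] sees only those below [M]. *)
  have mix m : sat psi (cas (fun x : A => val x) (dd (fun l => if (l < m)%N then s' l else s l))).
    elim: m => [//|m]; apply: (dd1 psi m) => l /eqP lm.
    by rewrite ltnS [(l <= m)%N]leq_eqVlt (negbTE lm).
  by apply: sat_extW (mix M) => -[//|[l x]] /MP lM /=; rewrite /dd /= lM.
pose th : formula L ((A + 'I_n) + nat * unit) := rename (smap id (fun x => (x, tt))) phi.
pose all1 : nat -> bool := fun=> true.
exists th, (fun l z => dd all1 (l, z.1)); split=> [l i psi []|s].
have [||c cP] := elementary_extension mon a (V := A + nat * nat)
    (v := cas (fun x : A => val x) (dd (fun l => asbool (s l))))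
    (v' := cas (fun x : A => val x) (dd all1)).
- apply: small_sum => //; last exact: small_ord mon _.
  by apply: small_sum => //; apply: small_prod.
- by move=> psi; apply: ddE.
exists c; split=> [psi pp|l].
  pose h (z : A + 'I_n) : (A + nat * nat) + 'I_n := smap inl id z.
  have /sat_rename : sat (rename h psi) (cas (cas (fun x : A => val x) (dd all1)) c).
    by apply/cP/sat_rename; apply: sat_extW (ap psi pp) => -[].
  by apply: sat_extW => -[].
pose h (z : (A + 'I_n) + nat) : (A + nat * nat) + 'I_n := match z with
  | inl (inl x) => inl (inl x) | inl (inr i) => inr i | inr x => inl (inr (l, x)) end.
have := ddP (fun l => asbool (s l)) l; rewrite asboolE => <-.
have -> : sat phi (cas (cas (fun x : A => val x) a)
      (fun x => dd (fun l => asbool (s l)) (l, x))) <->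
    sat (rename h phi) (cas (cas (fun x : A => val x) (dd (fun l => asbool (s l)))) a).
  by rewrite sat_rename; apply: sat_ext => -[[]|].
by rewrite cP /th 2!sat_rename; apply: (@sat_ext _ _ _ phi) => -[[]|].
Qed.

End Independence.

(** * Translation to the indiscernibility used in the statement *)

Section Conversion.
Variables (kbar : Type) (L : language) (T : set (sentence L)) (C : structure L).
Hypothesis mon : monster kbar T C.

Definition nat_sequence (u : nat -> C) : sequence kbar C :=
  @Sequence kbar L C _ nat infinite_nat (small_nat mon) unit (small_unit mon)
    (fun m _ => u m).

(** Each parameter is a value of [b] or an entry of another block; [q] turns it into a variable of
    this kind, which makes the hypothesis on [v] applicable. *)
Lemma blocks_mutually_indiscernible (K P : Type) (b : P -> C) (v : K * nat -> C) :
  (forall (i : K) m (phi : formula L ((P + K * nat) + 'I_m)) (j j' : 'I_m -> nat),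
      (forall k y, occ phi (inl (inr (k, y))) -> k <> i) ->
      (forall x y, (j x < j y)%N = (j' x < j' y)%N) ->
      sat phi (cas (cas b v) (fun x => v (i, j x))) ->
      sat phi (cas (cas b v) (fun x => v (i, j' x)))) ->
  mutually_indiscernible (fun i => nat_sequence (fun m => v (i, m))) (range b).
Proof.
move=> vP i m j j' hj hj' phi.
have ordE (j1 : 'I_m -> nat) : {homo j1 : k l / (k < l)%O} ->
    forall x y, (j1 x < j1 y)%N = (x < y)%N.
  move=> hj1 x y; case: (ltngtP x y) => [xy|yx|/val_inj->]; last by rewrite ltnn.
    exact: (hj1 x y xy).
  by have /ltnW := hj1 y x yx; rewrite leqNgt => /negbTE.
move: phi; set B := _ `|` _ => phi.
have /choice[q qP] : forall x : B, exists q : P + K * nat,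
    cas b v q = val x /\ forall k y, q = inr (k, y) -> k <> i.
  move=> x; have [[p _ <-]|[k ki [y [w <-]]]] := set_mem (valP x).
    by exists (inl p).
  by exists (inr (k, y)); split=> // k' y' [<-].
pose h (z : B + 'I_m * unit) : (P + K * nat) + 'I_m := smap q fst z.
have hE (j1 : 'I_m -> nat) :
    psat phi (subtuple (s := nat_sequence (fun m => v (i, m))) j1) <->
    sat (rename h phi) (cas (cas b v) (fun x => v (i, j1 x))).
  rewrite sat_rename; apply: sat_ext => -[x|[x w]] _ //=.
  by rewrite (qP x).1.
have oh k y : occ (rename h phi) (inl (inr (k, y))) -> k <> i.
  by rewrite occ_rename => -[[x|//] _ [/(qP x).2]]; apply.
by rewrite !hE; split; apply: vP => // x y; rewrite !ordE.
Qed.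

Lemma not_indiscernible_nat (P W : Type) (b : P -> C) (a : W -> C) (u : nat -> C)
    (phi : formula L ((P + W) + nat * unit)) (g g' : nat -> nat) :
  increasing g -> increasing g' ->
  ~ (sat phi (cas (cas b a) (fun z => u (g z.1))) <->
     sat phi (cas (cas b a) (fun z => u (g' z.1)))) ->
  ~ indiscernible (nat_sequence u) (range b `|` range a).
Proof.
move=> ig ig' nphi ind; apply: nphi; have [M MP] := occ_row_bound phi.
pose B := range b `|` range a.
have Bb p : B (b p) by left; exists p.
have Ba w : B (a w) by right; exists w.
pose h (z : (P + W) + nat * unit) : B + 'I_M.+1 * unit := match z with
  | inl (inl p) => inl (SigSub (mem_set (Bb p)))
  | inl (inr w) => inl (SigSub (mem_set (Ba w)))
  | inr x => inr (inord x.1, tt) end.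
pose jj (g1 : nat -> nat) (x : 'I_M.+1) : Defs.index (nat_sequence u) := g1 x.
have jhomo g1 : increasing g1 -> {homo jj g1 : k l / (k < l)%O}.
  by move=> ig1 x y xy; apply: ig1.
have hE g1 : sat phi (cas (cas b a) (fun z => u (g1 z.1))) <->
    psat (rename h phi : pformula B _) (subtuple (jj g1)).
  rewrite /psat sat_rename; apply: sat_ext => -[[p|w]|[i w]] //= /MP iM.
  by rewrite /subtuple /jj /= inordK // ltnS ltnW.
by rewrite !hE; apply: ind; apply: jhomo.
Qed.

End Conversion.

(* [formula L nat] has cardinality |T|; [KT + KA] has cardinality |T|^+ + |A|^+. *)
Theorem theorem1p5 (L : language) (T : set (sentence L)) (kbar : Type)
    (C : structure L) (A : set C) (n : nat) (p : set (pformula A 'I_n))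
    (KT KA : Type) :
  complete_theory T ->
  monster kbar T C ->
  card_lt A [set: kbar] ->
  partial_type p ->
  independent kbar p ->
  is_succ_card [set: formula L nat] KT ->
  is_succ_card A KA ->
  exists A' : set C, A `<=` A' /\ finite_set (A' `\` A) /\
  exists a : 'I_n -> C, realizes a p /\
  exists I : KT + KA -> sequence kbar C,
    [/\ forall i, of_singletons (I i),
        mutually_indiscernible I A'
      & forall i, ~ indiscernible (I i) (A' `|` range a)].
Proof.
move=> _ mon ltA _ indep succT succA.
have lim := monster_strong_limit mon.
have sK : small kbar (KT + KA).
  apply: small_sum => //; first exact: small_succ (monster_language_small mon) succT.
  exact: small_succ ltA succA.
have sA := (small_set_type _ _).1 ltA.
have sU := small_unit mon; have sn := small_ord mon n.
(* Realizations of [p] are shattered against elements. The first exchange gives a sequence of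
   realizations broken by one element over the parameters [q0]. *)
have [th0 sh0] := independent_shatters mon ltA indep.
have [k0 [q0 br0]] := shatters_broken mon sA sn sU sh0.
have sP0 : small kbar (A + 'I_k0 * unit).
  by apply: small_sum => //; apply: small_prod => //; apply: small_ord mon _.
(* Now single elements are shattered against sequences of realizations, so the second exchange gives
   a sequence of elements broken by one realization of [p]. *)
have [th1 sh1] := broken_shatters mon sP0 sU sn br0.
have [k1 [q1 br1]] := shatters_broken mon sP0 sU sn sh1.
have sP1 : small kbar ((A + 'I_k0 * unit) + 'I_k1 * 'I_n).
  by apply: small_sum => //; apply: small_prod => //; apply: small_ord mon _.
have [a [v [aY mutv brv]]] := broken_blocks mon sK sP1 sn br1.
set b := cas (cas _ q0) q1 in aY mutv brv.
exists (range b); split=> [x Ax|].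
  by exists (inl (inl (SigSub (mem_set Ax)))).
split.
  (* The parameters added to [A] are the values of [q0] and [q1], both indexed by finite types. *)
  apply: (@sub_finite_set _ _ (range (cas q0 q1))); last exact: finite_image.
  move=> _ [[[[x|y]|y] _ <-] nA].
  - by case: nA; apply: set_mem (valP x).
  - by exists (inl y).
  - by exists (inr y).
exists a; split; first by move/real_lift: aY => /real_lift.
exists (fun i => nat_sequence mon (fun m => v (i, m))); split.
- by move=> i; exists tt => -[].
- exact: blocks_mutually_indiscernible.
- move=> i; have [phi [g [g' [ig ig' nphi]]]] := brv i.
  exact: not_indiscernible_nat ig ig' nphi.
Qed.
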